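(* Let $c_0$ be a proper $4$-colouring of the plane, let $\mu$ be a left-invariant finitely additive probability measure on $S_4\times E(2)$, and let $p_d$ be the associated monochromaticity probabilities (see context). If $0\le d\le\frac{\sqrt5-1}{\sqrt3}$, then $p_d\ge\frac1{325}$.
   Context: Identify the plane with $\mathbb C$. A proper $4$-colouring of the plane is a map $c_0:\mathbb C\to\{1,2,3,4\}$ such that no two points at distance $1$ have the same colour. Let $S_4$ be the group of permutations of the colours and $E(2)$ the group of Euclidean isometries of the plane. The group $S_4\times E(2)$ is amenable, so there is a finitely additive probability measure $\mu$ defined on all subsets of $S_4\times E(2)$ which is left-invariant, i.e. $\mu(gE)=\mu(E)$ for all $g\in S_4\times E(2)$ and $E\subseteq S_4\times E(2)$. For $(\sigma,T)\in S_4\times E(2)$ consider the (random) colouring $c=\sigma\circ c_0\circ T^{-1}$. For $d\ge 0$, $p_d$ denotes the probability that two points $A,B$ at distance $d$ get the same colour: $p_d=\mu(\{(\sigma,T): c(A)=c(B)\})$; by left-invariance this does not depend on the choice of $A,B$ with $|AB|=d$. The existence of $c_0$ is a standing assumption, and $c_0,\mu$ are arbitrary but fixed. *)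

(* Defs.v *)
From HB Require Import structures.
From mathcomp Require Import all_boot all_order all_algebra all_fingroup.
From mathcomp Require Import boolp classical_sets reals.
From mathcomp Require Import complex.

Set Implicit Arguments.
Unset Strict Implicit.
Unset Printing Implicit Defensive.

Import Order.TTheory GRing.Theory Num.Theory.

Local Open Scope classical_set_scope.
Local Open Scope complex_scope.
Local Open Scope ring_scope.

(* The plane is [R[i]]; the norm [`|z|] of a complex number is again an element
   of [R[i]], so that a real distance [d] appears as [d%:C]. *)

Definition proper_colouring (R : realType) (c0 : R[i] -> 'I_4) : Prop :=
  forall z w : R[i], `|z - w| = 1 -> c0 z <> c0 w.

(* A Euclidean isometry of the plane, bundled with its (unique) inverse. *)
Record euclidean (R : realType) : Type := Euclidean {
  euclidean_fun :> R[i] -> R[i];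
  euclidean_inv : R[i] -> R[i];
  euclidean_funK : cancel euclidean_fun euclidean_inv;
  euclidean_invK : cancel euclidean_inv euclidean_fun;
  euclidean_dist :
    forall z w, `|euclidean_fun z - euclidean_fun w| = `|z - w| }.

Section EuclideanGroup.
Variable R : realType.
Implicit Types T U V : euclidean R.

Lemma euclidean_ext T U : (forall z, T z = U z) -> T = U.
Proof.
case: T => f f' fK f'K fd; case: U => g g' gK g'K gd /= /funext fg.
subst g; have fg' : f' = g'.
  by apply: funext => z; rewrite -{1}[z]g'K fK.
by subst g'; congr Euclidean; apply: Prop_irrelevance.
Qed.

Definition euclidean_id : euclidean R :=
  @Euclidean R idfun idfun (frefl _) (frefl _) (fun _ _ => erefl).

Lemma euclidean_inv_dist T z w :
  `|euclidean_inv T z - euclidean_inv T w| = `|z - w|.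
Proof. by rewrite -(euclidean_dist T) !euclidean_invK. Qed.

Definition euclidean_opp T : euclidean R :=
  Euclidean (euclidean_invK T) (euclidean_funK T) (euclidean_inv_dist T).

Lemma euclidean_comp_dist T U z w : `|T (U z) - T (U w)| = `|z - w|.
Proof. by rewrite !euclidean_dist. Qed.

Definition euclidean_comp T U : euclidean R :=
  @Euclidean R (T \o U) (euclidean_inv U \o euclidean_inv T)
    (can_comp (euclidean_funK T) (euclidean_funK U))
    (can_comp (euclidean_invK U) (euclidean_invK T))
    (euclidean_comp_dist T U).

Lemma euclidean_compA : associative euclidean_comp.
Proof. by move=> T U V; apply: euclidean_ext. Qed.

Lemma euclidean_comp1 : left_id euclidean_id euclidean_comp.
Proof. by move=> T; apply: euclidean_ext. Qed.

Lemma euclidean_comp1r : right_id euclidean_id euclidean_comp.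
Proof. by move=> T; apply: euclidean_ext. Qed.

Lemma euclidean_compV : left_inverse euclidean_id euclidean_opp euclidean_comp.
Proof. by move=> T; apply: euclidean_ext => z /=; rewrite euclidean_funK. Qed.

Lemma euclidean_compVr : right_inverse euclidean_id euclidean_opp euclidean_comp.
Proof. by move=> T; apply: euclidean_ext => z /=; rewrite euclidean_invK. Qed.

HB.instance Definition _ := gen_eqMixin (euclidean R).
HB.instance Definition _ := gen_choiceMixin (euclidean R).
HB.instance Definition _ := isGroup.Build (euclidean R)
  euclidean_compA euclidean_comp1 euclidean_comp1r
  euclidean_compV euclidean_compVr.

End EuclideanGroup.

(* The group $S_4 \times E(2)$, both factors with composition of maps as their
   product. The product of [{perm _}] is composition in the reverse order
   ([permM : (s * t) x = t (s x)]), whence the swap in the first component. *)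
Definition symE (R : realType) : Type := ('S_4 * euclidean R)%type.

Definition symE_mul (R : realType) (g h : symE R) : symE R :=
  ((h.1 * g.1)%g, (g.2 * h.2)%g).

Definition fin_additive_probability (R : realType) (G : Type)
    (mu : set G -> R) : Prop :=
  [/\ forall E, 0 <= mu E,
      mu setT = 1
    & forall E F, E `&` F = set0 -> mu (E `|` F) = mu E + mu F].

Definition left_invariant (R : realType) (mu : set (symE R) -> R) : Prop :=
  forall (g : symE R) (E : set (symE R)), mu (symE_mul g @` E) = mu E.

Definition random_colouring (R : realType) (c0 : R[i] -> 'I_4) (g : symE R) :
    R[i] -> 'I_4 :=
  fun z => g.1 (c0 ((g.2^-1)%g z)).

Lemma random_colouring_mul (R : realType) (c0 : R[i] -> 'I_4) (h g : symE R) z :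
  random_colouring c0 (symE_mul h g) z =
  h.1 (random_colouring c0 g ((h.2^-1)%g z)).
Proof. by rewrite /random_colouring /= permM. Qed.

(* This is $p_d$ for every pair [A], [B] at distance [d]; when [mu] is
   left-invariant, it depends on [A] and [B] only through their distance. *)
Definition mono_prob (R : realType) (c0 : R[i] -> 'I_4)
    (mu : set (symE R) -> R) (A B : R[i]) : R :=
  mu [set g | random_colouring c0 g A = random_colouring c0 g B].

(* Main.v *)
(* No proper 4-colouring of the plane exists (de Grey), so the bound holds
   vacuously.  Call three points z + u, z + u w^2, z + u w^4 (|u| = 1, w a
   primitive sixth root of unity) a triple of the unit hexagon around z.

   1. No triple is monochromatic: otherwise the colours of the hexagon and its
      centre are known up to symmetry, and a finite unit distance graph around
      it, taken from de Grey's construction, cannot be coloured.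
   2. Let J be the 31 points of the triangular lattice at distance at most
      sqrt 7 from z.  By 1, every colouring of J gives some antipodal pair
      z + 2 u w^k, z - 2 u w^k the colour of z; and if z + 2 u and z - 2 u both
      avoid the colour of z, then all three antipodal pairs are monochromatic.
   3. Rotate J about z so that points at distance 2 from z move by 1.  An
      antipodal pair of the rotated copy with the colour of z forces the second
      alternative of 2, so any two points at distance 4 have the same colour.
      Rotating such a pair about one of its points so that the other one moves
      by 1 is a contradiction.

   The colourings of the two finite graphs are refuted by sequences of derived
   clauses that were found with a SAT solver. *)
From HB Require Import structures.
From Stdlib Require Import ZArith FMapPositive.
Require Import Defs.
From mathcomp Require Import all_boot all_order all_algebra all_fingroup.
From mathcomp Require Import boolp classical_sets reals.
From mathcomp Require Import complex ring lra ssrZ.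

Set Implicit Arguments.
Unset Strict Implicit.
Unset Printing Implicit Defensive.

Import Order.TTheory GRing.Theory Num.Theory.

Local Open Scope Z_scope.

(** Steps 1 to 3 are proved for every centre [z] and every direction [u], so the rotated copies that
    one explicit non-4-colourable graph would have to contain become instances of a lemma. Only two
    graphs then need a certificate: the 31 points of J, and 617 points around the hexagon of step 1.
    The rotations of step 3 never enter the finite data, so one fixed shape of coordinates suffices.
    It contains the sixth root of unity w and (sqrt 33 + i sqrt 3) / 6, whose square (5 + i sqrt 11)
    / 6 is the rotation of the Moser spindle (it moves points at distance sqrt 3 by 1). Over the
    denominator 12 the vertices have integer numerators, and unit distance is decided exactly.

    The refutations are untrusted: a derived clause is accepted when assuming its negation and
    replaying the listed propagation steps ends in a contradiction. Hence only the soundness of this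
    replay has to be proved. *)

Module PM := PositiveMap.

(* (a, b, c, d) stands for ((a + b sqrt 33) + i (c sqrt 3 + d sqrt 11)) / 12. *)
Definition point := (Z * Z * Z * Z)%type.

(* The vertices of a graph are numbered from 1 and listed with those of their
   neighbours that a refutation refers to. *)
Definition graph := seq (point * seq Z).

(* Sets of colours are bit masks, and (v, m) says that the colour of v is in m;
   a clause is the disjunction of its entries. *)
Definition clause := seq (Z * Z).

(* A derived clause comes with the steps of its unit propagation: v > 0 removes
   the colours of the neighbours of v from v, and i < 0 applies clause number -i. *)
Definition refutation := seq (clause * seq Z).

(** * Checking refutations by unit propagation on colour masks *)

(** Lists become binary tries so that the many lookups by number stay cheap under [vm_compute]. *)
Fixpoint table (T : Type) (k : positive) (s : seq T) : PM.t T :=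
  if s is x :: s' then PM.add k x (table (Pos.succ k) s') else PM.empty T.

Definition neighbours (g : PM.t (point * seq Z)) (v : Z) : seq Z :=
  if PM.find (Z.to_pos v) g is Some x then x.2 else [::].

(** A vertex without an entry is unconstrained: 15 is the mask of all four colours. *)
Definition colours (d : PM.t Z) (v : Z) : Z :=
  if PM.find (Z.to_pos v) d is Some m then m else 15.

Definition restrict (d : PM.t Z) (v m : Z) : PM.t Z :=
  PM.add (Z.to_pos v) (Z.land (colours d v) m) d.

Definition single (m : Z) : bool :=
  match m with 1 | 2 | 4 | 8 => true | _ => false end.

Definition shave (d : PM.t Z) (nb : seq Z) (m : Z) : Z :=
  foldr (fun u m => let s := colours d u in
                    if single s then Z.ldiff m s else m) m nb.

Definition live (d : PM.t Z) (c : clause) : clause :=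
  seq.filter (fun e => ~~ (Z.land (colours d e.1) e.2 =? 0)) c.

(** Only the listed steps are executed, without any search, so the cost is that of the certificate.
    A clause with two or more live entries forces nothing and is passed over; running out of steps
    or citing an unknown clause rejects the certificate. *)
Fixpoint conflict (g : PM.t (point * seq Z)) (db : PM.t clause)
    (d : PM.t Z) (steps : seq Z) : bool :=
  match steps with
  | [::] => false
  | Zneg i :: steps' =>
      if PM.find i db is Some c then
        match live d c with
        | [::] => true
        | [:: e] => conflict g db (restrict d e.1 e.2) steps'
        | _ => conflict g db d steps'
        end
      else false
  | v :: steps' =>
      let m := shave d (neighbours g v) (colours d v) in
      if m =? 0 then true else conflict g db (PM.add (Z.to_pos v) m d) steps'
  end.

(** The starting point for deriving [c]: the domains under the assumption that every entry of [c]
    fails. *)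
Definition exclude (d : PM.t Z) (c : clause) : PM.t Z :=
  foldr (fun e d => PM.add (Z.to_pos e.1) (Z.ldiff (colours d e.1) e.2) d) d c.

(** A derived unit clause shrinks the domains for good, so later derivations profit from it without
    citing it. *)
Definition learn (d : PM.t Z) (c : clause) : PM.t Z :=
  if c is [:: e] then restrict d e.1 e.2 else d.

(** [k] is the number that the next derived clause receives. Running out of clauses is a failure, so
    success requires the empty clause. *)
Fixpoint check (g : PM.t (point * seq Z)) (k : positive)
    (db : PM.t clause) (d : PM.t Z) (r : refutation) : bool :=
  if r is (c, steps) :: r' then
    conflict g db (exclude d c) steps &&
    (if c is [::] then true
     else check g (Pos.succ k) (PM.add k c db) (learn d c) r')
  else false.

(** The given clauses carry the numbers 1 to [size init], so the first derived one gets [size init]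
    + 1. Despite its type, [facts] is read as a conjunction. *)
Definition refutes (g : graph) (facts : clause) (init : seq clause)
    (r : refutation) : bool :=
  check (table 1 g) (Pos.of_succ_nat (size init)) (table 1 init)
    (foldr (fun e d => restrict d e.1 e.2) (PM.empty Z) facts) r.

(** Soundness does not depend on which key holds which entry, only on a table returning nothing but
    entries of its list. *)
Lemma find_table (T : eqType) (s : seq T) k i x :
  PM.find i (table k s) = Some x -> x \in s.
Proof.
elim: s k => [|y s IH] k /=; first by rewrite PM.gempty.
rewrite inE; have [->|ne] := Pos.eq_dec i k.
  by rewrite PM.gss => -[->]; rewrite eqxx.
by rewrite PM.gso // => /IH ->; rewrite orbT.
Qed.

(** * Soundness of the checker for a fixed colouring of the vertices *)

Section Soundness.
Variable f : positive -> 'I_4.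

(** [v] is read through [Z.to_pos] exactly as in the table lookups, so a number that is not positive
    denotes vertex 1 on both sides. *)
Definition colour (v : Z) : 'I_4 := f (Z.to_pos v).
Definition allowed (m : Z) (c : 'I_4) : bool := Z.testbit m (Z.of_nat c).
Definition compatible (d : PM.t Z) : Prop :=
  forall v, allowed (colours d v) (colour v).
Definition holds (c : clause) : bool :=
  has (fun e => allowed e.2 (colour e.1)) c.

Lemma allowed0 c : allowed 0 c = false.
Proof. by rewrite /allowed Z.testbit_0_l. Qed.

Lemma allowed_land m m' c :
  allowed (Z.land m m') c = allowed m c && allowed m' c.
Proof. exact: Z.land_spec. Qed.

Lemma allowed_ldiff m m' c :
  allowed (Z.ldiff m m') c = allowed m c && ~~ allowed m' c.
Proof. exact: Z.ldiff_spec. Qed.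

Lemma allowed15 c : allowed 15 c.
Proof. by case: c => [[|[|[|[|]]]]]. Qed.

Lemma single_allowed m c c' : single m -> allowed m c -> allowed m c' -> c = c'.
Proof.
move=> sm mc mc'; apply: val_inj; move: sm mc mc'.
case: c c' => [[|[|[|[|//]]]] ?] [[|[|[|[|//]]]] ?] //=;
  (* If the two colours differ, one of them is below 3, so the last three binary digits of [m]
     settle every case. *)
  by case: m => // -[p|p|] //; case: p => // -[p|p|] //; case: p => // -[p|p|].
Qed.

Lemma compatible_add d v m :
  compatible d -> allowed m (colour v) -> compatible (PM.add (Z.to_pos v) m d).
Proof.
move=> cd mv u; rewrite /colours /colour.
have [->|ne] := Pos.eq_dec (Z.to_pos u) (Z.to_pos v); first by rewrite PM.gss.
by rewrite PM.gso //; apply: cd.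
Qed.

Lemma compatible_restrict d v m :
  compatible d -> allowed m (colour v) -> compatible (restrict d v m).
Proof. by move=> cd mv; apply: compatible_add; rewrite // allowed_land cd. Qed.

Lemma compatible_empty : compatible (PM.empty Z).
Proof. by move=> v; rewrite /colours PM.gempty allowed15. Qed.

Lemma compatible_exclude d c :
  compatible d -> ~~ holds c -> compatible (exclude d c).
Proof.
move=> cd; elim: c => [//|e c IH] /=; rewrite negb_or => /andP[ne nc].
by apply: compatible_add; [exact: IH | rewrite allowed_ldiff IH].
Qed.

(** An entry that is true of the colouring has the actual colour of its vertex both in its own mask
    and in the domain, so the intersection is nonempty and the entry survives the filter. *)
Lemma holds_live d c : compatible d -> holds c -> holds (live d c).
Proof.
move=> cd; rewrite /holds !has_count /live count_filter -!has_count.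
move=> /hasP[e ec ev]; apply/hasP; exists e => //=; rewrite ev /=.
apply/negP => /Z.eqb_eq E.
have := allowed_land (colours d e.1) e.2 (colour e.1).
by rewrite E allowed0 cd ev.
Qed.

Variable g : PM.t (point * seq Z).
Hypothesis proper_g :
  forall v u, u \in neighbours g v -> colour v <> colour u.

(** By compatibility a neighbour with a singleton domain really has that colour, and properness
    keeps it away from [v]. *)
Lemma allowed_shave d v : compatible d ->
  allowed (shave d (neighbours g v) (colours d v)) (colour v).
Proof.
move=> cd; rewrite /shave.
have: forall u, u \in neighbours g v -> colour v <> colour u.
  exact: proper_g.
elim: (neighbours g v) => [_|u s IH ne] /=; first exact: cd.
have {}IH : allowed _ _ := IH (fun w ws => ne w (mem_behead (s := u :: s) ws)).
case: ifP => // su; rewrite allowed_ldiff IH /=.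
apply/negP => au; apply: (ne u (mem_head _ _)).
exact: single_allowed su au (cd u).
Qed.

Lemma conflict_sound db d steps :
  (forall i c, PM.find i db = Some c -> holds c) ->
  compatible d -> conflict g db d steps -> False.
Proof.
move=> dbP; elim: steps d => [//|v steps IH] d cd.
(* Shared by the constructors [Z0] and [Zpos], which both end in the last branch of [conflict]. *)
have vertex : (let m := shave d (neighbours g v) (colours d v) in
    if m =? 0 then true
    else conflict g db (PM.add (Z.to_pos v) m d) steps) -> False.
  have av := allowed_shave v cd => /=; case: Z.eqb_spec => [E _|_].
    by move: av; rewrite E allowed0.
  by apply: IH; apply: compatible_add.
case: v vertex => [|v|i] vertex //=.
case E: (PM.find i db) => [c|//]; have := holds_live cd (dbP _ _ E).
case: (live d c) => [//|e [|e' l]]; last by move=> _; apply: IH.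
by rewrite /holds /= orbF => ae; apply: IH; apply: compatible_restrict.
Qed.

(** If [c] failed, the colouring would be compatible with [exclude d c], which the replay refutes.
    So [c] holds and may join the clauses. *)
Lemma check_sound k db d r :
  (forall i c, PM.find i db = Some c -> holds c) ->
  compatible d -> check g k db d r -> False.
Proof.
elim: r k db d => [//|[c steps] r IH] k db d dbP cd /= /andP[runs next].
have hc : holds c.
  apply/negPn/negP => nc.
  exact: conflict_sound dbP (compatible_exclude cd nc) runs.
(* The empty clause cannot hold, so deriving it is the desired contradiction. *)
case: c hc next {runs} => [//|e c] hc.
apply: IH => [i c'|].
  have [->|ne] := Pos.eq_dec i k; first by rewrite PM.gss => -[<-].
  by rewrite PM.gso // => /dbP.
case: c hc => [|//]; rewrite /holds /= orbF.
exact: compatible_restrict.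
Qed.

End Soundness.

Lemma refutes_sound (f : positive -> 'I_4) g facts init r :
  (forall v u, u \in neighbours (table 1 g) v ->
    colour f v <> colour f u) ->
  all (fun e => allowed e.2 (colour f e.1)) facts ->
  all (holds f) init ->
  refutes g facts init r -> False.
Proof.
move=> fg factsP initP; rewrite /refutes; apply: (check_sound fg).
  by move=> i c /find_table /(allP initP).
elim: facts factsP => [_|e s IH] /=; first exact: compatible_empty.
by move=> /andP[eP /IH sP]; apply: compatible_restrict.
Qed.

(** * Exact coordinates, unit vectors and the hexagon *)

Definition origin : point := (0, 0, 0, 0).

Definition subp (p q : point) : point :=
  let: (a, b, c, d) := p in let: (a', b', c', d') := q in
  (a - a', b - b', c - c', d - d').

(** As sqrt 3 times sqrt 11 is sqrt 33, the squared modulus times 144 is the left side of the first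
    equation plus 2 (a b + c d) sqrt 33. The two tests say that the rational part is 144 and that
    the irrational part vanishes. *)
Definition unit_vector (p : point) : bool :=
  let: (a, b, c, d) := p in
  (a * a + 33 * (b * b) + 3 * (c * c) + 11 * (d * d) =? 144) &&
  (a * b + c * d =? 0).

Definition coord (g : graph) (v : Z) : point :=
  if PM.find (Z.to_pos v) (table 1 g) is Some x then x.1 else origin.

(** An edge is checked where it is listed; adjacency lists need not be symmetric. *)
Definition unit_distance (g : graph) : bool :=
  all (fun x => all (fun u => unit_vector (subp x.1 (coord g u))) x.2) g.

Definition hex (k : nat) : point :=
  nth origin
    [:: (12, 0, 0, 0); (6, 0, 6, 0); (-6, 0, 6, 0);
        (-12, 0, 0, 0); (-6, 0, -6, 0); (6, 0, -6, 0)] k.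

Definition forbid (k : nat) : Z := Z.ldiff 15 (Z.shiftl 1 (Z.of_nat k)).

(** A clause can only mention fixed colours, so inequality takes one clause per colour [k]: some
    vertex of [vs] avoids [k]. *)
Definition not_all_equal (vs : seq Z) : seq clause :=
  [seq [seq (v, forbid k) | v <- vs] | k <- iota 0 4].

Lemma allowed_forbid k (c : 'I_4) :
  (k < 4)%N -> allowed (forbid k) c = (c != k :> nat).
Proof.
by case: c => [[|[|[|[|//]]]] ?]; case: k => [|[|[|[|]]]].
Qed.

Lemma allowed14 (c : 'I_4) : allowed 14 c = (c != inord 0).
Proof. by rewrite -[14]/(forbid 0) allowed_forbid // -val_eqE /= inordK. Qed.

Lemma holds_pair14 f v v' :
  holds f [:: (v, 14); (v', 14)] =
  (colour f v != inord 0) || (colour f v' != inord 0).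
Proof. by rewrite /holds /has orbF !allowed14. Qed.

Lemma holds_not_all_equal f vs v v' : v \in vs -> v' \in vs ->
  colour f v != colour f v' -> all (holds f) (not_all_equal vs).
Proof.
move=> vvs v'vs ne; apply/allP => cl /mapP[k]; rewrite mem_iota => k4 ->.
apply/hasP; have [e|nv] := eqVneq (colour f v : nat) k.
  exists (v', forbid k); first exact: map_f.
  by rewrite allowed_forbid // -e eq_sym.
by exists (v, forbid k); [exact: map_f | rewrite allowed_forbid].
Qed.

(** * The 31 lattice points of J and their refutations *)

(* Vertex 1 is the centre, 2 to 7 are its unit hexagon and 8 to 13 the vertices
   at distance 2, both in the order of [hex]. *)
Definition J_graph : graph := [:: (0,0,0,0,[::5; 6]); (12,0,0,0,[::8; 26]);
  (6,0,6,0,[::9; 23]); (-6,0,6,0,[::1; 3; 5; 23]); (-12,0,0,0,[::1; 4; 6; 11;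
  18]); (-6,0,-6,0,[::1; 5; 7; 18; 22]); (6,0,-6,0,[::1; 2; 6; 13; 22; 26]);
  (24,0,0,0,[::26; 27; 31]); (12,0,12,0,[::3; 23; 27; 29]); (-12,0,12,0,[::4;
  19; 23]); (-24,0,0,0,[::5; 14; 18; 19]); (-12,0,-12,0,[::6; 18; 22]);
  (12,0,-12,0,[::7; 22; 26]); (-30,0,-6,0,[::18]); (-30,0,6,0,[::11; 19]);
  (-24,0,-12,0,[::12; 14; 18]); (-24,0,12,0,[::10; 15; 19]); (-18,0,-6,0,[::5;
  6; 11; 12; 14; 16]); (-18,0,6,0,[::4; 5; 10; 11]); (-6,0,-18,0,[::12; 22;
  24]); (-6,0,18,0,[::10; 23]); (0,0,-12,0,[::6; 7; 12; 13]); (0,0,12,0,[::4;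
  9; 10]); (6,0,-18,0,[::13; 20; 22]); (6,0,18,0,[::9; 21; 23]);
  (18,0,-6,0,[::2; 7; 8; 13]); (18,0,6,0,[::2; 3; 8; 9; 31]);
  (24,0,-12,0,[::13; 26; 30]); (24,0,12,0,[::9; 27; 31]); (30,0,-6,0,[::8;
  26]); (30,0,6,0,[::8; 27])].

(* (h, p, q, r): the points p, q, r are a triple of the hexagon around h. *)
Definition J_triples : seq (Z * Z * Z * Z) := [:: (18,6,11,16); (18,5,14,12);
  (19,4,17,11); (19,10,15,5); (5,1,19,18); (5,4,11,6); (6,7,5,12); (6,1,18,22);
  (4,3,10,5); (4,23,19,1); (22,13,6,20); (22,7,12,24); (1,2,4,6); (1,3,5,7);
  (23,9,21,4); (23,25,10,3); (7,26,1,22); (7,2,6,13); (3,27,23,1); (3,9,4,2);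
  (2,8,3,7); (2,27,1,26); (26,30,2,13); (26,8,7,28); (27,31,9,2); (27,29,3,8)].

(** Clauses 1 to 3 are [link_clauses] and 4 to 107 are [wheel_clauses] (26 triples, four colours
    each); derived clauses start at 108. *)
Definition J_proof0 : refutation := [:: ([::(5,14)], [::1]); ([::(6,14)],
  [::1]); ([::(4,10)], [::4]); ([::(23,11)], [::3]); ([::(7,12)], [::7]);
  ([::(9,11)], [::3]); ([::(26,13)], [::2]); ([::(27,9)], [::27]); ([::(8,13)],
  [::2]); ([::(9,10); (13,11)], [::7; -2; 26; 22; -68; 6; 12; 24; -51; 20;
  -46]); ([::(31,14)], [::27; 8; -86; 26; 29; -106; 9; 13; -117; 22; -68; 6;
  -73]); ([::(7,4); (18,13)], [::6; 5; 4; 12; -31; -2; -81; 27; 23; -76]);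
  ([::(14,14); (6,10); (16,10)], [::11; 16; -6; 7; 18; -119; 11; 5]);
  ([::(7,4); (13,13)], [::-119; -93; 6; -73; 22; 18; -32; 12; 5; 26; -68; 14;
  16; -120; -9; 8; 11; -1; 30; 28; -99]); ([::(13,10); (22,14)], [::13; 7; 26;
  -68]); ([::(7,4); (12,7); (5,4); (13,14)], [::18; -119; -31; 6; 4; 18; 10;
  -3; 19; -20; 11; 10; 15; -17; 17; -15]); ([::(12,14); (23,8); (19,14)],
  [::-2; -40; 9; 4; 10; 21; -63; 25; -66]); ([::(18,4); (12,6); (5,4); (26,8);
  (13,14)], [::26; 7; -119; -123; 18; 5; 4; 23; 19; -124; 10; -3; 8; 11; -1;
  27; 23; -76]); ([::(6,10)], [::7; 13; -121; 22; -122; 18; 12; 5; 26; -125;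
  26; -117; -88; 8; 31; 9; -101]); ([::(6,8)], [::-73; -53; 5; 10; -38; -58;
  13; 22; -122; 13; -3; 23; 19; -40]); ([::(8,8)], [::7; -86; -1; 5; -58; 4;
  11; -27; 19; 18; -20]); ([::], [::7; 27; 26; -88])].

(** In this refutation and the next two, clauses 1 to 4 say that one antipodal pair is not
    monochromatic, so [wheel_clauses] are 5 to 108 and derived clauses start at 109. *)
Definition J_proof1 : refutation := [:: ([::(5,14)], [::1]); ([::(4,10)],
  [::4]); ([::(23,11)], [::3]); ([::(7,12)], [::7]); ([::(27,9)], [::27]);
  ([::(8,12)], [::2]); ([::(8,8); (5,6)], [::-87; 11; -3; -32; 4; 6; -26; 18;
  12; 22; -33]); ([::(13,11)], [::7; 26; 22; -69; 6; -89; 8; 5; -115; 20; -47;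
  11; -3; 18; 12; 20; 24; -52]); ([::(8,8)], [::-87; 26; 13; 22; -69; 6; -74]);
  ([::(11,6)], [::-4]); ([::(23,10)], [::27; -77]); ([::(5,12)], [::4; 11; 27;
  23; 19; 9; 10; 21; -64; 25; -67]); ([::(4,8)], [::23; 27; 9; -82]); ([::],
  [::5; 23; 11; 19; 10; -39])].

Definition J_proof2 : refutation := [:: ([::(6,14)], [::1]); ([::(4,10)],
  [::4]); ([::(23,11)], [::3]); ([::(7,12)], [::7]); ([::(9,11)], [::3]);
  ([::(26,13)], [::2]); ([::(27,9)], [::27]); ([::(8,12)], [::2]); ([::(9,10);
  (13,11)], [::7; -1; 26; 22; -69; 6; 12; 24; -52; 20; -47]); ([::(7,4);
  (13,13)], [::-94; 6; -74; 26; 22; -69; 8; 30; 28; -100]); ([::(13,11)], [::7;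
  -117; 26; -89; 9; 8; 31; -102; 29; -107]); ([::(23,3)], [::9; 4; -82; 27; 8;
  -87; 26; 13; -118]); ([::(6,10)], [::7; 13; -118; 26; 22; 8; 27; -77; 9; 4;
  5; 21; -64; 12; -4; 18; 11; 19; 10; 21; 25; -67]); ([::(26,5)], [::8; 7;
  -87]); ([::(8,8)], [::26; -87; 6; 13; -74]); ([::], [::27; -77; 4; -89; 7; 6;
  5; 13; -118; 22; 10; -39; 19; 11; 18; 9; 12; -4])].

Definition J_proof3 : refutation := [:: ([::(5,14)], [::1]); ([::(6,14)],
  [::1]); ([::(4,10)], [::4]); ([::(23,11)], [::3]); ([::(7,12)], [::7]);
  ([::(9,11)], [::3]); ([::(26,13)], [::2]); ([::(27,9)], [::27]); ([::(8,12)],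
  [::2]); ([::(23,3)], [::4; -54; 9; -82; 27; 8; -87; 26; 6; 5; 12; -32; 22;
  -69; 12; 18; 11; 19; 10; 13; -3]); ([::(23,1); (13,11)], [::4; 7; 10; -3; 26;
  22; -69; 6; 5; 19; 11; 18; 12; 24; -52; 20; -47]); ([::(7,4); (22,6)], [::22;
  26; -69; 8; 13; 30; -94; 28; -100]); ([::(22,6)], [::-120; -87; 27; 26;
  -89]); ([::(13,7)], [::7; -87; 27; 26; -89]); ([::(13,5)], [::22; 7; 6;
  -74]); ([::(26,5)], [::8; 7; -87]); ([::(23,1)], [::4; -119; 26; 8; 27; 9;
  10; -1; 21; -64; 25; -67]); ([::], [::-77; 8; 9; 31; -102; 29; -107])].

(** Symmetry breaking: vertices 1, 2, 3 form a unit triangle, so their colours may be taken to be 0,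
    1, 2, with masks 1, 2, 4. *)
Definition J_facts : clause := [:: (1, 1); (2, 2); (3, 4)].

Definition wheel_clauses : seq clause :=
  flatten [seq not_all_equal [:: t.1.1.2; t.1.2; t.2] | t <- J_triples].

(** [k] is 0 or 1 according to which of the two triples of the hexagon is meant. *)
Definition wheel_triple (k : nat) (t : Z * Z * Z * Z) : bool :=
  let: (h, p, q, r) := t in let x := coord J_graph in
  [&& subp (x p) (x h) == hex k, subp (x q) (x h) == hex (k + 2) &
      subp (x r) (x h) == hex (k + 4)].

Lemma J_triples_wheel :
  all (fun t => has (wheel_triple^~ t) (iota 0 2)) J_triples.
Proof. by vm_compute. Qed.

Lemma J_unit_distance : unit_distance J_graph.
Proof. by vm_compute. Qed.

(* Vertices 8 + k and 11 + k are antipodal, and 14 excludes the colour 0 of the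
   centre. *)
Definition link_clauses : seq clause :=
  [:: [:: (8, 14); (11, 14)]; [:: (9, 14); (12, 14)]; [:: (10, 14); (13, 14)]].

Lemma link_clauses_refuted :
  refutes J_graph J_facts (link_clauses ++ wheel_clauses) J_proof0.
Proof. by vm_compute. Qed.

(** The same list as the first of [link_clauses], but used as a conjunction: both ends of the first
    antipodal pair avoid the colour of the centre. *)
Definition link_facts : clause := [:: (8, 14); (11, 14)].

(** Assuming any one of the three pairs bichromatic contradicts [link_facts]; for [k] = 0 it is the
    very pair that [link_facts] speaks of. *)
Lemma link_facts_refuted k : (k < 3)%N ->
  refutes J_graph (link_facts ++ J_facts)
    (not_all_equal [:: Z.of_nat (8 + k); Z.of_nat (11 + k)] ++ wheel_clauses)
    (nth [::] [:: J_proof1; J_proof2; J_proof3] k).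
Proof. by case: k => [|[|[|//]]] _; vm_compute. Qed.

(** * The graph that excludes a monochromatic triple *)

(* Vertex 1 is the centre and 2 to 7 are its unit hexagon. *)
Definition M_graph : graph := [:: (0,0,0,0,[::108; 109; 205; 211; 219; 256;
  257; 266; 267; 338; 339; 352; 354; 421; 422; 432; 433; 469; 475; 478; 484;
  558; 559]); (12,0,0,0,[::399; 400; 505; 510; 513; 518; 540; 541; 547; 548;
  577; 578; 585; 586; 599; 600; 604; 605; 611; 614; 615; 617]);
  (6,0,6,0,[::240; 241; 365; 375; 380; 424; 425; 435; 436; 491; 492; 501; 502;
  543; 544; 550; 551; 570; 575; 583; 609]); (-6,0,6,0,[::34; 80; 90; 94; 96;
  126; 127; 135; 136; 188; 189; 200; 201; 259; 260; 269; 270; 318; 327; 333;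
  459; 460]); (-12,0,0,0,[::8; 10; 26; 29; 37; 38; 43; 44; 71; 72; 82; 84; 123;
  124; 132; 133; 168; 174; 183; 290; 291]); (-6,0,-6,0,[::33; 87; 89; 93; 120;
  121; 129; 130; 186; 196; 197; 254; 263; 264; 310; 316; 326; 342; 450; 451]);
  (6,0,-6,0,[::1; 6; 231; 373; 419; 488; 572]); (-24,0,0,0,[::15; 53]);
  (-23,1,-1,1,[::13; 29; 66; 93]); (-22,0,0,2,[::33; 34; 109]);
  (-21,1,-1,3,[::33; 35; 46; 93; 132]); (-20,0,-6,-2,[::26; 53; 149]);
  (-20,0,0,4,[::36; 46; 57; 109; 155]); (-20,0,6,-2,[::29; 53; 112; 159]);
  (-19,-1,-5,-1,[::32; 33; 63; 121; 168]); (-19,-1,7,-1,[::17; 34; 63]);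
  (-19,1,5,-1,[::8; 34; 35; 183]); (-18,0,-6,0,[::5; 6; 9; 36; 66; 149]);
  (-18,0,-2,0,[::37; 43; 77; 152; 191]); (-18,0,0,6,[::11; 62; 68; 155]);
  (-18,0,2,0,[::25; 44; 45; 156]); (-18,0,6,0,[::4; 5; 25; 46; 159]);
  (-18,2,-4,0,[::18; 19; 42]); (-18,2,0,0,[::43; 48; 81; 163; 199]);
  (-18,2,4,0,[::9; 22; 46; 66; 82; 86; 166; 200]); (-17,-1,-5,1,[::10; 90; 168;
  205]); (-17,-1,7,1,[::14; 29; 57; 72; 90; 175; 212]); (-17,1,-3,1,[::26; 95;
  178]); (-17,1,5,1,[::10; 61; 86; 93; 96; 183; 219]); (-17,1,7,-1,[::80; 84;
  184]); (-17,3,3,1,[::29; 82; 221]); (-16,-2,-4,2,[::15; 33; 90; 186; 223]);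
  (-16,0,-6,2,[::93; 109; 231]); (-16,0,6,2,[::35; 68; 90; 96; 109; 241]);
  (-16,2,4,2,[::11; 34; 93; 99; 200; 247]); (-15,-1,-5,3,[::18; 109; 124; 205;
  254]); (-15,-1,-1,3,[::20; 111]); (-15,-1,1,-3,[::14; 43; 72; 121; 208;
  257]); (-15,-1,3,3,[::46; 72; 77; 258]); (-15,-1,5,-3,[::22; 45; 77; 123;
  259]); (-15,1,-7,3,[::114; 213; 263]); (-15,1,-3,3,[::19; 36; 37; 76; 134]);
  (-15,1,-1,-3,[::12; 38; 82; 105; 116; 135; 266]); (-15,1,1,3,[::20; 107; 136;
  217; 267]); (-15,1,3,-3,[::25; 77; 131]); (-15,1,5,3,[::11; 13; 25; 77; 109;
  118; 132; 219; 269]); (-15,1,7,-3,[::22; 79; 85; 270]); (-15,3,-1,3,[::24;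
  42; 44; 82; 141; 275]); (-15,3,3,3,[::25; 46; 114]); (-14,-2,-4,4,[::26; 51;
  124; 223]); (-14,0,-6,4,[::13; 26; 119; 132; 155; 231]); (-14,0,-2,4,[::88;
  93; 134]); (-14,0,0,-2,[::90; 93; 135; 149; 159; 235; 290]);
  (-14,0,0,2,[::126; 130; 236]); (-14,0,2,4,[::61; 90; 122; 136; 292]);
  (-14,0,4,2,[::91; 132; 294]); (-14,0,6,4,[::29; 124; 155; 241; 296]);
  (-14,0,12,-2,[::14; 96; 127; 159; 297]); (-14,2,-2,-2,[::53; 93; 166]);
  (-14,2,2,2,[::56; 94; 136; 138; 246; 302]); (-14,2,4,4,[::29; 31; 57; 95;
  132; 142; 162; 247; 303]); (-13,-1,-5,5,[::32; 33; 155; 254]);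
  (-13,-1,1,-1,[::66; 103; 109; 144; 159; 168; 175; 257; 318]);
  (-13,-1,5,-1,[::34; 111; 170]); (-13,1,-5,-1,[::33; 181; 324]);
  (-13,1,-1,-1,[::17; 18; 25; 63; 109; 149; 176; 183; 266; 326]);
  (-13,1,1,1,[::22; 184; 267; 327]); (-13,1,5,5,[::34; 155; 269]);
  (-13,1,7,-1,[::34; 117; 332]); (-12,-2,-6,0,[::36; 170; 337]);
  (-12,-2,-2,0,[::188; 282]); (-12,-2,2,0,[::27; 38; 124; 175; 186; 339]);
  (-12,-2,6,0,[::77; 126; 187]); (-12,0,-8,0,[::28; 70; 129; 178]);
  (-12,0,-6,6,[::36; 41; 120; 192; 286; 344]); (-12,0,-4,0,[::36; 82; 121; 122;
  131; 193; 345]); (-12,0,4,0,[::46; 72; 84; 126; 134; 135; 170; 191; 293;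
  347]); (-12,0,6,-6,[::127; 135; 295; 348]); (-12,0,8,0,[::85; 86; 127; 173;
  193]); (-12,0,12,0,[::22; 27; 86; 175; 350]); (-12,2,-6,0,[::74; 76; 129]);
  (-12,2,-2,0,[::25; 48; 132; 185; 200; 352]); (-12,2,0,6,[::44; 132; 300]);
  (-12,2,2,0,[::44; 45; 77; 133; 134; 178; 197; 201; 301; 354]);
  (-12,2,6,0,[::46; 77; 79; 135; 136; 181; 199; 356]); (-12,2,10,0,[::29; 183;
  200; 305; 357]); (-11,-1,-11,1,[::33; 205]); (-11,-1,-3,1,[::50; 93; 144;
  152; 193; 210; 315; 363]); (-11,-1,-1,-1,[::153; 188; 211; 316]);
  (-11,-1,1,1,[::34; 93; 186; 205; 318; 365]); (-11,-1,3,-1,[::94; 148; 189;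
  191; 366]); (-11,1,-3,-1,[::89; 153; 161]); (-11,1,-1,1,[::29; 33; 53; 90;
  163; 200; 219; 326; 373]); (-11,1,1,-1,[::89; 91; 197; 327; 375]);
  (-11,1,3,1,[::55; 61; 90; 166; 191; 329; 376]); (-11,1,11,1,[::29; 34; 219;
  333; 380]); (-11,3,-3,1,[::93; 162; 221]); (-11,3,1,1,[::93; 95; 163]);
  (-11,3,9,1,[::35; 96; 200; 221; 335; 383]); (-10,-2,-10,2,[::36; 205; 223]);
  (-10,-2,-2,2,[::109; 167; 210]); (-10,-2,2,-2,[::206; 229; 339]);
  (-10,-2,2,2,[::32; 63; 109; 212; 223; 339; 391]); (-10,-2,6,-2,[::38; 209;
  340]); (-10,0,-6,-4,[::168; 176; 394]); (-10,0,-4,-2,[::38; 209; 345]);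
  (-10,0,-4,2,[::62; 114; 168; 217; 345]); (-10,0,0,-2,[::40; 67; 179; 240;
  399]); (-10,0,0,2,[::13; 33; 34; 36; 46; 63; 66; 180; 205; 219; 231; 241;
  400]); (-10,0,4,-2,[::43; 104; 216; 347]); (-10,0,4,2,[::68; 103; 173; 183;
  207; 234; 404]); (-10,0,6,-4,[::116; 175; 183; 405]); (-10,2,-6,-2,[::43;
  216; 351]); (-10,2,-2,2,[::35; 66; 107; 109; 178; 213; 221; 247; 352; 406]);
  (-10,2,2,2,[::109; 181; 185; 214; 222]); (-10,2,4,-4,[::43; 112; 183; 185;
  410]); (-10,2,6,2,[::111; 183; 245]); (-10,2,10,2,[::35; 46; 219; 247; 357]);
  (-9,-1,-11,3,[::36; 231; 254; 360]); (-9,-1,-7,3,[::37; 234; 256; 418]);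
  (-9,-1,-5,-3,[::15; 131; 186; 224; 257; 419]); (-9,-1,-3,3,[::132; 186; 191;
  238; 363; 420]); (-9,-1,-1,-3,[::131; 133; 187; 191]); (-9,-1,1,3,[::72; 132;
  134; 192; 193; 241; 254; 365; 422]); (-9,-1,3,-3,[::72; 77; 133; 135; 188;
  193; 255; 261; 423]); (-9,-1,5,3,[::77; 134; 136; 256]); (-9,-1,7,-3,[::16;
  58; 135; 189; 226; 257; 369; 425]); (-9,-1,11,-3,[::80; 137; 427]);
  (-9,1,-7,-3,[::121; 266; 429]); (-9,1,-5,3,[::76; 120; 122; 245; 267; 371;
  430]); (-9,1,-3,-3,[::76; 82; 123; 191; 197; 268; 431]); (-9,1,-1,3,[::46;
  61; 82; 124; 231; 247; 269; 373; 432]); (-9,1,1,-3,[::84; 125; 193; 199; 232;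
  270; 374; 433]); (-9,1,3,3,[::77; 124; 193; 200; 234; 265; 376; 434]);
  (-9,1,5,-3,[::53; 77; 127; 200; 266; 272; 435]); (-9,1,7,3,[::85; 142; 201;
  238; 267; 379]); (-9,1,9,-3,[::79; 86; 127]); (-9,3,-3,3,[::49; 82; 132;
  277]); (-9,3,1,3,[::83; 132; 134; 199; 273]); (-9,3,3,-3,[::59; 135; 200]);
  (-9,3,5,3,[::134; 136; 200]); (-9,3,9,3,[::61; 86; 247; 277; 383]);
  (-8,-2,-10,4,[::87; 254; 384]); (-8,-2,-4,-2,[::63; 149; 205; 257; 285;
  441]); (-8,-2,0,-2,[::64; 90; 207]); (-8,-2,0,2,[::89; 157; 254]);
  (-8,-2,2,4,[::50; 90; 155; 250; 260; 281; 391]); (-8,-2,4,2,[::157; 256; 283;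
  447]); (-8,0,-6,-2,[::18; 53; 66; 205; 213; 266; 290; 450]);
  (-8,0,-6,2,[::256; 291; 451]); (-8,0,-4,4,[::162; 205; 214]);
  (-8,0,-2,-2,[::88; 93; 144; 207; 214; 215; 293; 453]); (-8,0,-2,2,[::19; 89;
  164; 258; 263; 398]); (-8,0,0,-4,[::259; 264; 399]); (-8,0,0,4,[::68; 90; 93;
  147; 254; 269; 296; 400]); (-8,0,2,-2,[::90; 95; 145; 166; 210; 217; 270;
  456]); (-8,0,2,2,[::21; 94; 260; 265; 402]); (-8,0,4,4,[::147; 210; 219;
  289]); (-8,0,6,-2,[::53; 166; 212; 219; 290; 297; 459]); (-8,0,6,2,[::54;
  267; 291; 460]); (-8,2,-4,2,[::23; 60; 153; 267; 463]); (-8,2,-2,4,[::61; 93;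
  155; 214; 263; 277; 406]); (-8,2,0,-2,[::93; 152; 156; 215; 217; 264; 278]);
  (-8,2,0,2,[::24; 269; 273]); (-8,2,2,-4,[::270; 274; 408]); (-8,2,4,-2,[::25;
  66; 95; 156; 159; 219; 221; 298; 305; 410; 466]); (-7,-3,-3,-1,[::72; 168;
  223; 285]); (-7,-1,-5,-1,[::26; 63; 176; 231; 290; 318; 419; 469]);
  (-7,-1,-3,1,[::72; 106; 177]); (-7,-1,-1,-1,[::77; 109; 167; 234; 235; 293;
  312; 320; 421; 471]); (-7,-1,1,1,[::73; 76; 102; 108; 179; 236; 237; 288;
  321; 422]); (-7,-1,1,5,[::109; 296; 422]); (-7,-1,3,-1,[::79; 103; 111; 181;
  183; 238; 315; 423]); (-7,-1,5,1,[::184; 240; 291; 424]); (-7,-1,7,-1,[::63;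
  72; 80; 183; 241; 285; 297; 318; 323; 476]); (-7,1,-7,-1,[::66; 82; 168; 231;
  326]); (-7,1,-5,1,[::106; 113; 291]); (-7,1,-3,-1,[::107; 114; 168; 170; 234;
  244; 301; 329; 431]); (-7,1,-1,1,[::77; 233; 330; 432; 480]);
  (-7,1,-1,5,[::68; 109; 114; 245; 286; 331; 432; 481]); (-7,1,1,-1,[::85; 109;
  115; 170; 185; 235; 238; 245; 304; 332; 433; 482]); (-7,1,3,1,[::79; 82; 174;
  434; 483]); (-7,1,5,-1,[::29; 86; 175; 239; 241; 247; 290; 326; 333; 435;
  484]); (-7,1,7,1,[::67; 80; 84; 302; 327; 436; 485]); (-7,3,3,-1,[::82; 181;
  183; 247; 298; 335; 439; 486]); (-6,-2,-4,0,[::90; 121; 122; 191; 254; 318;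
  339; 488]); (-6,-2,0,0,[::124; 191; 193; 256; 257; 320; 489]);
  (-6,-2,4,0,[::125; 193; 252; 258; 259; 307; 446; 491]); (-6,-2,8,0,[::72;
  127; 260; 323; 339; 448]); (-6,0,-4,6,[::122; 130; 265]); (-6,0,-2,0,[::77;
  132; 186; 197; 199; 256; 265; 266; 329; 347; 453]); (-6,0,0,6,[::124; 132;
  256; 267; 331; 455]); (-6,0,2,0,[::76; 124; 125; 134; 187; 188; 199; 200;
  257; 258; 268; 325; 349; 456; 496]); (-6,0,4,6,[::134; 258; 269]);
  (-6,0,10,0,[::77; 189; 261; 320; 347]); (-6,2,-8,0,[::82; 334; 352; 461]);
  (-6,2,-4,0,[::84; 130; 131; 138; 191; 264; 265; 354]); (-6,2,-2,6,[::138;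
  192; 265]); (-6,2,0,0,[::85; 132; 191; 193; 202; 266; 267; 324; 356; 500]);
  (-6,2,4,0,[::25; 82; 93; 99; 134; 135; 193; 268; 269; 326; 501]);
  (-6,2,8,0,[::84; 95; 142; 329; 467; 502]); (-6,4,2,0,[::140; 200; 277]);
  (-5,-3,-3,1,[::144; 205; 207; 281; 339; 359]); (-5,-3,3,-1,[::148; 209;
  503]); (-5,-1,-5,1,[::90; 109; 149; 203; 213; 281; 365; 469; 505]);
  (-5,-1,-3,-1,[::216; 339; 343; 470]); (-5,-1,-1,1,[::111; 152; 155; 203; 217;
  289; 290; 337; 347; 361; 471; 506]); (-5,-1,1,-5,[::156; 285; 290]);
  (-5,-1,1,-1,[::38; 154; 218; 291; 340; 345; 362; 370]); (-5,-1,3,1,[::147;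
  217; 219; 285; 293; 349; 363]); (-5,-1,5,-1,[::40; 89; 108; 220; 294; 475;
  510]); (-5,-1,7,1,[::27; 90; 103; 159; 219; 296; 339; 365; 476; 511]);
  (-5,1,-7,1,[::93; 114; 149; 205; 352; 373; 477]); (-5,1,-3,1,[::95; 115; 162;
  205; 207; 298; 376]); (-5,1,-1,-5,[::43; 116; 152; 163; 290; 298; 377]);
  (-5,1,-1,-1,[::43; 291; 347; 351]); (-5,1,1,1,[::107; 117; 155; 156; 207;
  210; 221; 290; 292; 356; 371; 379; 482; 517]); (-5,1,3,-1,[::165; 211; 302;
  349; 352; 372]); (-5,1,5,1,[::29; 46; 93; 96; 109; 159; 212; 221; 293; 296;
  357; 373; 380; 484; 518]); (-5,1,7,-1,[::30; 47; 350; 354; 375]);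
  (-5,3,3,1,[::99; 114; 166; 219; 301; 352; 383; 486]); (-5,3,7,1,[::98; 219;
  354]); (-4,-2,-4,2,[::32; 124; 168; 231; 234; 365; 488]); (-4,-2,0,-2,[::121;
  233; 237; 308; 316; 489]); (-4,-2,0,2,[::172; 234; 238; 367; 489]);
  (-4,-2,2,-4,[::173; 239; 318]); (-4,-2,4,-2,[::237; 319; 387; 491]);
  (-4,-2,4,2,[::173; 241; 309; 320; 491]); (-4,-2,8,-2,[::125; 366; 492]);
  (-4,-2,8,2,[::103; 175; 241]); (-4,0,-6,2,[::7; 33; 51; 109; 132; 168; 223;
  314; 373; 400; 523]); (-4,0,-4,-4,[::168; 178; 315]); (-4,0,-2,-2,[::110;
  125; 129; 169; 224; 316; 325; 366; 403; 493]); (-4,0,-2,2,[::111; 134; 170;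
  180; 223; 315; 326; 376; 404]); (-4,0,0,-4,[::53; 121; 135; 244; 318; 326;
  405; 494; 526]); (-4,0,0,4,[::126; 130; 179; 316; 327; 495]);
  (-4,0,2,-2,[::127; 131; 319; 327; 496]); (-4,0,2,2,[::122; 172; 173; 181;
  228; 247; 318; 329; 363; 379; 396; 496]); (-4,0,4,-4,[::173; 183; 320; 329;
  397]); (-4,0,6,-2,[::128; 133; 184; 375]); (-4,0,6,2,[::34; 109; 124; 175;
  183; 247; 331; 365; 380; 400; 529]); (-4,0,12,-4,[::58; 333; 405]);
  (-4,2,-4,2,[::178; 234; 409]); (-4,2,-2,-4,[::116; 235; 326; 334; 410; 531]);
  (-4,2,0,2,[::180; 181; 234; 238; 326; 371; 500]); (-4,2,2,4,[::136; 138;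
  327]); (-4,2,4,2,[::35; 132; 183; 238; 241; 331; 373; 383; 501]);
  (-4,2,8,2,[::134; 241; 332; 335; 376; 502]); (-3,-3,-5,-3,[::145; 186; 337]);
  (-3,-3,-3,3,[::186; 254; 391]); (-3,-3,1,3,[::187; 258; 339]);
  (-3,-3,3,-3,[::188; 257; 259; 339; 536]); (-3,-1,-7,-3,[::6; 264; 343]);
  (-3,-1,-5,3,[::124; 186; 190; 250; 263; 400; 422; 505]); (-3,-1,-3,-3,[::186;
  191; 249; 266; 423; 539]); (-3,-1,-1,3,[::120; 126; 158; 187; 191; 192; 250;
  265; 267; 338; 404; 424; 506]); (-3,-1,1,-3,[::63; 159; 193; 266; 268; 339;
  419; 425; 541]); (-3,-1,3,3,[::188; 193; 267; 269; 339; 347; 509]);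
  (-3,-1,5,-3,[::188; 252; 268; 270; 347; 348; 389; 421; 543]);
  (-3,-1,7,3,[::124; 189; 269; 271; 349; 422; 511]); (-3,-1,9,-3,[::125; 189;
  270; 272; 349; 423]); (-3,1,-11,3,[::130; 150; 342; 430]); (-3,1,-7,3,[::132;
  162; 196; 254; 393; 432]); (-3,1,-5,-3,[::65; 133; 255; 274; 345; 351; 407;
  433]); (-3,1,-3,3,[::134; 191; 254; 256; 345; 352; 434; 514]);
  (-3,1,-1,-3,[::66; 135; 149; 191; 257; 276; 352; 410; 435; 547]);
  (-3,1,1,3,[::44; 192; 193; 199; 256; 258; 277; 353; 354; 411; 436; 548]);
  (-3,1,3,-3,[::152; 193; 200; 257; 347; 354; 355]); (-3,1,5,3,[::46; 68; 132;
  200; 260; 347; 356; 400; 432; 518; 550]); (-3,1,7,-3,[::69; 133; 201; 259;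
  279; 348; 349; 356; 401; 433]); (-3,1,9,3,[::201; 357; 404]);
  (-3,1,11,-3,[::135; 159; 405; 435]); (-3,3,-5,3,[::139; 197; 263; 265]);
  (-3,3,-3,-3,[::197; 264; 266; 352]); (-3,3,-1,3,[::199; 265; 267]);
  (-3,3,1,-3,[::199; 268; 354]); (-3,3,3,3,[::162; 200; 269; 354; 406]);
  (-3,3,5,-3,[::200; 268; 270; 356]); (-3,3,9,-3,[::272; 357; 553]);
  (-2,-2,-10,-2,[::144; 168; 441]); (-2,-2,-4,4,[::50; 143; 147; 205; 286; 289;
  422]); (-2,-2,-2,-2,[::203; 207; 290; 423]); (-2,-2,-2,2,[::71; 418; 447]);
  (-2,-2,0,4,[::207; 292; 365]); (-2,-2,2,-2,[::72; 144; 175; 210; 290; 293;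
  365; 425; 441; 448; 555]); (-2,0,-6,4,[::51; 155; 180; 205; 213; 281; 432;
  455; 523]); (-2,0,-4,-2,[::156; 181; 205; 214; 282; 298; 456]);
  (-2,0,-4,2,[::206; 299; 422; 428; 457]); (-2,0,-2,4,[::52; 207; 214; 281;
  363; 373]); (-2,0,0,-2,[::53; 159; 168; 183; 217; 301; 365; 373; 419; 435;
  459; 558]); (-2,0,0,2,[::209; 424; 430; 451]); (-2,0,2,4,[::210; 217; 303;
  365; 376; 436]); (-2,0,4,-2,[::77; 170; 210; 219; 285; 301; 304; 367; 376;
  377; 421; 453; 560]); (-2,0,4,2,[::77; 153; 211; 302; 366; 368; 426; 432]);
  (-2,0,6,-4,[::378; 427; 433]); (-2,0,6,4,[::57; 155; 212; 219; 303; 455;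
  529]); (-2,0,12,-2,[::159; 305; 380; 425; 459; 562]); (-2,2,-2,-2,[::82; 166;
  185; 290; 373; 381; 466; 563]); (-2,2,-2,2,[::82; 182; 434]);
  (-2,2,0,4,[::217; 292; 373; 440]); (-2,2,2,-2,[::84; 217; 290; 293; 376;
  431]); (-2,2,2,2,[::84; 184; 294; 375; 436]); (-2,2,4,4,[::61; 162; 180; 219;
  221; 292; 296; 376; 432; 532]); (-2,2,6,-2,[::163; 219; 293; 377; 433]);
  (-2,2,10,-2,[::86; 183; 380; 435; 466; 566]); (-1,-3,-9,-1,[::186; 310;
  441]); (-1,-3,-1,-1,[::225; 446; 534]); (-1,-3,1,1,[::186; 316; 535]);
  (-1,-3,3,-1,[::189; 318; 391; 536]); (-1,-1,-11,-1,[::87; 168; 450; 469]);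
  (-1,-1,-9,1,[::186; 442; 537]); (-1,-1,-7,-1,[::191; 231; 306; 394]);
  (-1,-1,-5,1,[::325; 472; 538]); (-1,-1,-5,5,[::62; 172; 223; 231; 385; 396;
  455]); (-1,-1,-3,-1,[::88; 193; 223; 234; 326; 386; 456; 474]);
  (-1,-1,-1,1,[::188; 325; 327; 399; 540]); (-1,-1,-1,5,[::234; 388; 400]);
  (-1,-1,1,-1,[::90; 168; 175; 186; 225; 235; 238; 326; 400; 401; 459; 469;
  476; 541; 570]); (-1,-1,3,1,[::91; 189; 191; 327; 402; 470; 542; 571]);
  (-1,-1,5,-1,[::170; 187; 228; 241; 309; 329; 332; 405; 471]);
  (-1,-1,7,1,[::193; 229; 330; 457; 544]); (-1,-1,9,-1,[::173; 188; 332; 333;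
  446]); (-1,-1,13,-1,[::189; 448; 476]); (-1,1,-5,-1,[::181; 231; 312; 315;
  394; 396]); (-1,1,-3,1,[::92; 182; 193; 196; 233; 316; 398; 457; 483; 546]);
  (-1,1,-1,-1,[::66; 93; 176; 183; 200; 244; 318; 400; 450; 484; 547; 572]);
  (-1,1,1,1,[::197; 316; 319; 399; 548]); (-1,1,1,5,[::238; 400; 409]);
  (-1,1,3,-1,[::191; 238; 247; 318; 320; 404; 410; 453; 479; 549]);
  (-1,1,5,1,[::195; 199; 240; 550]); (-1,1,5,5,[::68; 241; 247; 404; 455;
  550]); (-1,1,7,-1,[::193; 241; 248; 320; 335; 405; 456; 551]);
  (-1,1,11,-1,[::96; 183; 323; 459; 484]); (-1,3,-3,-1,[::185; 326; 406; 486]);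
  (-1,3,9,-1,[::99; 185; 200; 333; 412; 466; 486]); (0,-2,-10,0,[::186; 205;
  469]); (0,-2,-6,0,[::187; 207; 254; 345; 419; 471]); (0,-2,-2,0,[::204; 210;
  250; 255; 256; 413; 421; 474; 491]); (0,-2,2,0,[::72; 186; 189; 212; 257;
  347; 422; 423; 476; 488]); (0,-2,6,0,[::187; 259; 260; 347; 349; 425; 489]);
  (0,-2,10,0,[::188; 261; 349; 350; 426; 491]); (0,0,-12,0,[::7; 213]);
  (0,0,-8,0,[::74; 191; 214; 263; 336; 337; 429; 479; 493]); (0,0,-6,6,[::75;
  192; 263; 481]); (0,0,-4,0,[::107; 193; 217; 254; 255; 264; 352; 419; 420;
  431; 472; 482; 496]); (0,0,-2,6,[::256; 265; 420]); (0,0,4,0,[::77; 111; 191;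
  207; 259; 268; 269; 339; 340; 354; 356; 423; 435; 493; 560]);
  (0,0,6,-6,[::112; 259; 270; 425; 435]); (0,0,8,0,[::193; 210; 260; 356; 357;
  425; 426; 436; 474; 496]); (0,0,12,0,[::3; 4; 212; 357; 476; 583]);
  (0,2,-6,0,[::199; 263; 343; 345; 429; 500]); (0,2,-2,0,[::82; 200; 213; 221;
  266; 345; 431; 432; 486; 501]); (0,2,0,6,[::346; 432; 438]); (0,2,2,0,[::84;
  201; 214; 220; 267; 268; 277; 347; 433; 434; 439; 502]); (0,2,4,-6,[::116;
  215; 435]); (0,2,6,0,[::85; 199; 217; 269; 270; 347; 349; 435; 482; 500]);
  (0,2,10,0,[::118; 200; 219; 272; 350; 484; 501]); (1,-3,-9,1,[::223; 360;
  488]); (1,-3,3,1,[::285; 365; 367; 492]); (1,-1,-11,1,[::7; 87; 205; 231]);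
  (1,-1,-7,1,[::120; 234; 286; 358; 450; 493]); (1,-1,-5,-1,[::121; 224; 451;
  489]); (1,-1,-3,1,[::122; 210; 238; 281; 287; 373; 441; 453; 496; 568]);
  (1,-1,-1,-1,[::7; 454; 491]); (1,-1,1,1,[::90; 124; 205; 212; 241; 285; 290;
  292; 373; 376; 505; 570]); (1,-1,3,-1,[::91; 125; 206; 294; 375; 378; 447;
  492; 493]); (1,-1,5,1,[::293; 296; 376; 379; 459; 489]); (1,-1,5,5,[::126;
  236; 495]); (1,-1,7,-5,[::127; 242; 377; 448; 459; 507]); (1,-1,7,-1,[::127;
  237; 496]); (1,1,-5,1,[::245; 286; 361; 363; 381; 450; 500]);
  (1,1,-3,-1,[::131; 496; 498]); (1,1,-1,1,[::7; 93; 132; 219; 231; 247; 290;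
  365; 453; 501; 518; 572]); (1,1,1,-5,[::290; 301; 456]); (1,1,1,-1,[::94;
  133; 240; 291; 366; 457; 499]); (1,1,3,1,[::134; 234; 292; 293; 301; 303;
  365; 367; 456; 466; 493]); (1,1,5,-5,[::135; 215; 235; 293; 459; 466]);
  (1,1,5,-1,[::135; 216; 460; 497; 500; 516]); (1,1,7,1,[::217; 238; 296; 383;
  459; 496]); (1,1,11,1,[::96; 219; 241; 383; 518]); (1,3,-3,1,[::97; 221; 298;
  373; 464; 519]); (1,3,1,1,[::301; 373; 376]); (1,3,9,1,[::247; 380; 501;
  519]); (2,-2,-10,2,[::100; 254; 310; 505; 576]); (2,-2,-6,2,[::256; 469;
  506]); (2,-2,-4,-4,[::144; 257; 469]); (2,-2,-2,-2,[::227; 252; 253; 316;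
  399; 470; 577]); (2,-2,-2,2,[::228; 315; 400; 468; 471; 577]);
  (2,-2,0,-4,[::145; 249; 401]); (2,-2,2,-2,[::229; 255; 578]);
  (2,-2,2,2,[::103; 223; 260; 309; 318; 400; 404; 511; 578]);
  (2,-2,6,-2,[::104; 224; 257; 321; 403; 508; 579]); (2,0,-12,2,[::231; 310;
  384]); (2,0,-6,-4,[::149; 235; 266; 469; 477; 526; 592]); (2,0,-4,-2,[::106;
  257; 325; 387; 580]); (2,0,-4,2,[::151; 238; 267; 314; 315; 324; 388; 406;
  469]); (2,0,-2,-4,[::268; 315; 326; 386]); (2,0,-2,4,[::153; 258; 263; 325;
  470]); (2,0,0,-2,[::259; 264; 316; 327; 480]); (2,0,0,2,[::109; 155; 231;
  241; 254; 269; 318; 326; 328; 388; 391; 406; 409; 471; 482; 505; 518; 529;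
  594]); (2,0,2,-4,[::156; 255; 270; 318; 329; 410; 482; 595]);
  (2,0,2,4,[::157; 260; 265; 319; 327; 472]); (2,0,4,-2,[::233; 266; 319; 392;
  483; 516; 525; 581]); (2,0,4,2,[::234; 320; 329; 331; 391; 409; 484]);
  (2,0,6,-4,[::159; 235; 257; 332; 476; 484; 526; 530]); (2,2,-2,2,[::114; 247;
  277; 326; 334; 400; 512; 519; 532]); (2,2,0,-4,[::163; 326; 397; 482]);
  (2,2,2,-2,[::270; 274; 327; 586]); (2,2,2,2,[::248; 265; 329; 400; 404; 482;
  486]); (2,2,4,-4,[::166; 266; 329; 405; 484; 486; 597]); (2,2,6,2,[::331;
  404; 484]); (2,2,10,2,[::247; 269; 333; 518]); (3,-3,-3,-3,[::167; 252; 285;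
  419; 488; 536]); (3,-3,1,-3,[::423; 487; 489]); (3,-3,3,3,[::250; 283; 339;
  422]); (3,-3,9,-3,[::252; 425; 492; 536]); (3,-1,-11,3,[::119; 254; 342]);
  (3,-1,-7,3,[::7; 256; 337; 540]); (3,-1,-5,-3,[::7; 121; 168; 257; 280; 290;
  429; 431; 488; 526; 541; 598]); (3,-1,-3,3,[::122; 258; 292; 432; 488; 493]);
  (3,-1,-1,-3,[::259; 293; 338; 413; 414; 433; 489; 493; 494]);
  (3,-1,1,3,[::124; 254; 260; 281; 296; 339; 432; 496; 529; 538; 589]);
  (3,-1,3,-3,[::125; 255; 339; 347; 435; 490; 496]); (3,-1,5,3,[::126; 256;
  284; 340; 347; 434; 436; 491]); (3,-1,7,-3,[::175; 257; 285; 297; 349; 435;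
  437; 541; 602]); (3,-1,9,3,[::258; 341; 349; 436; 542]); (3,-1,11,-3,[::259;
  350; 437; 497; 543]); (3,1,-9,3,[::343; 418; 546]); (3,1,-7,-3,[::7; 176;
  266; 298; 419; 547]); (3,1,-5,3,[::7; 267; 300; 345; 351; 420; 548]);
  (3,1,-3,-3,[::178; 268; 301; 345; 352; 419; 421]); (3,1,-1,3,[::132; 180;
  269; 303; 352; 422; 493; 523; 550]); (3,1,1,-3,[::133; 181; 270; 287; 304;
  354; 421; 423; 439; 494; 496; 500; 551]); (3,1,3,3,[::134; 265; 347; 354;
  422; 496; 501]); (3,1,5,-3,[::183; 266; 290; 347; 423; 501]);
  (3,1,7,3,[::136; 267; 292; 349; 356; 424; 502; 548]); (3,1,9,-3,[::137; 293;
  349; 357; 502]); (3,3,1,3,[::139; 273; 500]); (3,3,3,-3,[::185; 298; 354;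
  433; 435; 501]); (3,3,5,3,[::356; 436; 501]); (4,-2,-4,-2,[::186; 285; 318;
  450; 505; 541]); (4,-2,-4,2,[::186; 308; 535]); (4,-2,0,-2,[::187; 320; 365;
  456]); (4,-2,0,2,[::146; 313; 508; 538]); (4,-2,2,4,[::147; 365; 509]);
  (4,-2,4,-2,[::367; 456; 459]); (4,-2,4,2,[::188; 316; 460; 510; 540]);
  (4,-2,8,-2,[::285; 369; 459; 511; 555]); (4,0,-10,-2,[::324; 360; 557]);
  (4,0,-6,-2,[::290; 310; 326; 505; 512; 547; 558; 608]); (4,0,-6,2,[::291;
  316; 513; 540]); (4,0,-4,4,[::292; 363; 464; 505; 514]); (4,0,-2,-2,[::152;
  191; 293; 312; 329; 363; 373; 441; 515; 560]); (4,0,-2,2,[::153; 191; 294;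
  319; 463; 542]); (4,0,0,4,[::155; 286; 365; 373; 445; 464; 550; 594]);
  (4,0,2,-2,[::156; 193; 287; 315; 332; 365; 376; 466; 507; 539]);
  (4,0,2,2,[::157; 193; 366; 375; 447; 544; 546]); (4,0,4,4,[::194; 367; 376]);
  (4,0,6,-2,[::159; 290; 318; 333; 448; 511; 518; 541; 558]); (4,0,6,2,[::291;
  327; 510; 548]); (4,2,-8,-2,[::450; 512; 563]); (4,2,-4,-2,[::301; 450;
  453]); (4,2,-4,2,[::197; 327; 451; 548]); (4,2,-2,4,[::162; 198; 303; 373;
  381; 455]); (4,2,0,-2,[::199; 324; 453]); (4,2,4,-2,[::200; 326; 376; 377;
  456; 459; 518; 547]); (4,2,8,-2,[::379; 383; 459; 549]); (5,-3,-3,-1,[::309;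
  339; 469; 520; 555; 567]); (5,-1,-5,-1,[::168; 205; 318; 477; 523; 558;
  570]); (5,-1,-3,1,[::311; 319; 339; 343; 387; 395; 480; 571]);
  (5,-1,-1,-1,[::170; 312; 320; 347; 388; 400; 468; 482; 526; 560; 599]);
  (5,-1,1,1,[::171; 209; 321; 340; 345; 390; 399; 483]); (5,-1,1,5,[::391; 400;
  481; 527]); (5,-1,3,-1,[::173; 210; 315; 322; 391; 484; 521; 568]);
  (5,-1,5,1,[::174; 211; 316; 341; 601]); (5,-1,7,-1,[::175; 212; 318; 323;
  339; 484; 529; 555; 570; 602; 612]); (5,1,-7,-1,[::176; 213; 326; 352; 394;
  469; 523; 572]); (5,1,-5,1,[::327; 524; 603]); (5,1,-3,-1,[::214; 354; 396;
  397; 406; 469; 531; 564]); (5,1,-1,1,[::347; 351; 399; 561; 604]);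
  (5,1,-1,5,[::180; 331; 344; 400; 406]); (5,1,1,-1,[::217; 332; 345; 356; 400;
  407; 471; 486; 526; 557]); (5,1,3,1,[::218; 352; 402; 408; 475; 528]);
  (5,1,5,-1,[::183; 219; 326; 357; 410; 476; 529; 558; 572]); (5,1,7,1,[::184;
  220; 327; 350; 354; 573]); (5,3,3,-1,[::185; 335; 352; 410; 482; 484]);
  (6,-4,2,0,[::415; 489; 535]); (6,-2,-4,0,[::7; 186; 223; 339; 365; 419; 493;
  570; 607]); (6,-2,0,0,[::187; 225; 337; 340; 367; 421; 422; 493; 496; 541]);
  (6,-2,2,-6,[::369; 494; 541]); (6,-2,4,0,[::188; 338; 341; 423; 424; 496;
  536; 577]); (6,-2,8,0,[::189; 230; 339; 359; 416; 425; 578]);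
  (6,0,-2,0,[::191; 234; 347; 376; 421; 432; 488; 489; 500; 547]);
  (6,0,0,-6,[::235; 348; 421; 433; 541; 547]); (6,0,0,6,[::422; 432; 548]);
  (6,0,2,0,[::193; 237; 238; 345; 349; 363; 379; 422; 423; 433; 434; 489; 491;
  500; 501; 541; 548; 549]); (6,0,10,0,[::347; 492; 581]); (6,2,-8,0,[::7; 352;
  429]); (6,2,-4,0,[::7; 243; 354; 382; 431; 493; 545; 586]); (6,2,0,0,[::199;
  356; 432; 433; 493; 496; 547; 548]); (6,2,4,0,[::200; 247; 352; 357; 373;
  435; 439; 496; 550; 572]); (6,2,8,0,[::201; 248; 354; 376; 551; 586]);
  (7,-3,3,-1,[::252; 447; 577]); (7,-1,-7,-1,[::364; 387; 577]);
  (7,-1,-5,1,[::205; 254; 365; 400; 611]); (7,-1,-1,1,[::256; 361; 443; 453;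
  455; 558; 581]); (7,-1,1,-5,[::257; 405; 456; 555; 558]); (7,-1,1,-1,[::257;
  362; 392; 395; 457; 580]); (7,-1,3,1,[::210; 363; 456; 517; 518]);
  (7,-1,5,-1,[::259; 364; 399]); (7,-1,7,1,[::212; 260; 365; 391; 448; 459;
  518; 578; 589]); (7,1,-7,1,[::213; 373; 406; 450; 505; 590]);
  (7,1,-5,-1,[::264; 399]); (7,1,-3,1,[::214; 265; 376; 453; 462; 464; 505;
  557; 563]); (7,1,-1,-5,[::266; 558; 563]); (7,1,-1,-1,[::216; 403; 454; 508;
  559; 584]); (7,1,1,1,[::456; 519; 558; 564]); (7,1,5,1,[::219; 269; 373; 380;
  400; 459; 509; 511; 614]); (7,3,3,1,[::277; 383; 466; 518; 585]);
  (8,-2,-4,2,[::391; 422; 469; 523; 589]); (8,-2,2,-4,[::285; 413; 425; 567]);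
  (8,-2,4,-2,[::227; 387; 416; 475]); (8,0,-6,2,[::231; 400; 417; 432; 469;
  477; 594; 615]); (8,0,-4,4,[::288; 402; 422]); (8,0,-2,-2,[::233; 470; 569]);
  (8,0,0,-4,[::235; 290; 419; 435; 570; 572; 596]); (8,0,2,2,[::292; 420; 532;
  570]); (8,0,4,4,[::294; 426; 571]); (8,0,6,2,[::241; 296; 400; 422; 476; 484;
  589; 594; 616]); (8,0,12,-4,[::425; 533; 596]); (8,2,-2,-4,[::298; 526; 572;
  597]); (8,2,4,2,[::247; 303; 406; 412; 432; 484; 529; 590]);
  (8,2,10,-4,[::305; 435; 575]); (9,-3,-1,-3,[::489; 539; 541]);
  (9,-3,1,3,[::251; 489; 540; 542; 578]); (9,-3,3,-3,[::252; 413; 448; 491;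
  541; 578]); (9,-1,-9,3,[::420; 452; 593]); (9,-1,-5,3,[::7; 254; 417; 422;
  488; 594]); (9,-1,-3,-3,[::315; 423; 456; 488; 493; 547]); (9,-1,-1,3,[::256;
  317; 424; 489; 493; 546; 548; 577]); (9,-1,1,-3,[::257; 318; 419; 425; 459;
  489; 494; 496; 547; 578; 602]); (9,-1,3,3,[::258; 420; 491; 496; 548; 550;
  578; 581]); (9,-1,5,-3,[::320; 421; 443; 491; 536; 551; 582]);
  (9,-1,7,3,[::260; 422; 550]); (9,1,-5,-3,[::264; 324; 433; 465; 539]);
  (9,1,-3,3,[::265; 434; 493; 499; 538; 540; 580; 585]); (9,1,-1,-3,[::266;
  326; 435; 450; 493; 494; 541; 585]); (9,1,1,3,[::267; 328; 436; 452; 496;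
  500; 542; 586]); (9,1,3,-3,[::268; 329; 496; 501; 541]); (9,1,5,3,[::269;
  432; 455; 501; 542]); (9,1,7,-3,[::270; 456; 543; 582; 595]);
  (9,1,11,-3,[::272; 333; 435; 459; 606]); (9,3,9,-3,[::335; 466; 552; 597]);
  (10,-2,-10,-2,[::441; 469; 607]); (10,-2,2,-2,[::285; 339; 441; 448; 476;
  509; 558; 589; 607]); (10,0,-6,4,[::286; 344; 505; 512]); (10,0,-4,-2,[::345;
  456; 482; 505; 514; 563; 587; 605]); (10,0,0,-2,[::290; 450; 459; 469; 484;
  589; 590; 608]); (10,0,0,2,[::291; 451; 460; 508; 601]); (10,0,4,-2,[::293;
  347; 471; 518; 555; 591; 599]); (10,0,4,2,[::347; 454; 604]);
  (10,0,12,-2,[::350; 459; 476]); (10,2,-2,-2,[::352; 466; 477; 486; 558;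
  590]); (10,2,2,-2,[::301; 354; 558]); (10,2,6,-2,[::356; 482; 560]);
  (10,2,10,-2,[::357; 466; 484]); (11,-3,3,-1,[::309; 492; 570]);
  (11,-1,-3,-1,[::315; 363; 496; 520; 572]); (11,-1,-1,1,[::7; 316; 475]);
  (11,-1,1,-1,[::318; 365; 469; 476; 488; 572; 609]); (11,-1,3,1,[::366; 492;
  493]); (11,1,-1,-1,[::7; 326; 373; 484; 501; 526; 570; 614]); (11,1,1,1,[::3;
  375; 499]); (11,1,3,-1,[::532; 570; 597]); (11,1,11,-1,[::380; 484; 609]);
  (12,-2,-10,0,[::336; 505; 611]); (12,-2,-2,0,[::338; 388; 491; 509; 539]);
  (12,-2,2,0,[::339; 391; 488; 492; 541; 600]); (12,-2,6,0,[::340; 489; 508;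
  581; 601; 602]); (12,0,-4,0,[::396; 496; 517; 539; 577; 585; 598]);
  (12,0,4,0,[::347; 403; 404; 493; 549; 550; 578; 586; 606]);
  (12,0,6,-6,[::405; 602; 606]); (12,0,12,0,[::511; 616]); (12,2,-6,0,[::351;
  545; 580]); (12,2,-2,0,[::352; 501; 547; 613]); (12,2,2,0,[::354; 409; 499;
  502; 514; 549; 605]); (13,-1,-5,-5,[::419; 526; 608]); (13,-1,-1,-1,[::364;
  421; 504; 510]); (13,-1,1,1,[::365; 422; 505; 511; 529; 558; 590; 616]);
  (13,1,-1,1,[::373; 432; 518; 523; 558; 589]); (13,1,5,-5,[::435; 526; 609]);
  (14,0,-6,-4,[::450; 526; 547]); (14,0,-4,2,[::527; 548; 568]);
  (14,0,0,2,[::400; 529; 550; 570; 572]); (14,0,2,-4,[::570; 574; 597]);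
  (14,0,6,-4,[::459; 541; 552; 612; 614]); (14,2,4,-4,[::410; 466; 547; 596;
  614]); (15,-1,-5,-3,[::469; 541; 554; 558]); (15,-1,-1,-3,[::421; 543]);
  (15,-1,1,3,[::538; 544]); (15,-1,5,3,[::424; 540; 579; 581; 616]);
  (15,-1,7,-3,[::476; 541; 555; 606; 616]); (15,1,-5,3,[::548; 580; 584]);
  (15,1,-1,3,[::432; 480; 481; 550; 556; 585]); (15,1,1,-3,[::482; 565]);
  (15,1,5,-3,[::435; 484; 547; 558; 616]); (16,-2,-4,-2,[::441; 488; 555; 570;
  608]); (16,0,-6,-2,[::7; 450; 558; 572; 607]); (16,0,6,-2,[::459; 558; 570]);
  (16,2,4,-2,[::466; 501; 566]); (17,-1,-5,-1,[::469; 505; 570]);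
  (17,-1,7,-1,[::476; 511; 570; 596; 614]); (17,1,-7,-1,[::512; 572; 592]);
  (17,1,5,-1,[::484; 518; 572; 575; 597; 617]); (18,0,-6,0,[::7; 590]);
  (18,0,6,0,[::2; 3; 529; 589; 602]); (22,0,0,-2,[::608; 609])].

(** No clauses are given, so clause number n is the n-th entry. The opening unit clauses only take
    from each vertex the colours of its neighbours among the vertices fixed by [M_facts]; the search
    proper begins with the first longer clause. *)
Definition M_proof : refutation := [:: ([::(183,11)], [::5]); ([::(375,11)],
  [::3]); ([::(570,11)], [::3]); ([::(135,14)], [::4]); ([::(38,11)], [::5]);
  ([::(94,14)], [::4]); ([::(502,11)], [::3]); ([::(600,14)], [::2]);
  ([::(459,14)], [::4]); ([::(205,13)], [::1]); ([::(37,11)], [::5]);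
  ([::(188,14)], [::4]); ([::(93,14)], [::6]); ([::(87,14)], [::6]);
  ([::(469,13)], [::1]); ([::(34,14)], [::4]); ([::(380,11)], [::3]);
  ([::(491,11)], [::3]); ([::(189,14)], [::4]); ([::(120,14)], [::6]);
  ([::(478,13)], [::1]); ([::(435,11)], [::3]); ([::(327,14)], [::4]);
  ([::(583,11)], [::3]); ([::(256,13)], [::1]); ([::(510,14)], [::2]);
  ([::(615,14)], [::2]); ([::(90,14)], [::4]); ([::(211,13)], [::1]);
  ([::(22,10)], [::22]); ([::(84,11)], [::5]); ([::(543,11)], [::3]);
  ([::(609,11)], [::3]); ([::(604,14)], [::2]); ([::(558,13)], [::1]);
  ([::(108,13)], [::1]); ([::(133,11)], [::5]); ([::(547,14)], [::2]);
  ([::(8,11)], [::5]); ([::(505,14)], [::2]); ([::(186,14)], [::6]);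
  ([::(436,11)], [::3]); ([::(540,14)], [::2]); ([::(350,10)], [::350]);
  ([::(513,14)], [::2]); ([::(421,13)], [::1]); ([::(399,14)], [::2]);
  ([::(617,14)], [::2]); ([::(260,14)], [::4]); ([::(333,14)], [::4]);
  ([::(96,14)], [::4]); ([::(129,14)], [::6]); ([::(475,13)], [::1]);
  ([::(259,14)], [::4]); ([::(80,14)], [::4]); ([::(127,14)], [::4]);
  ([::(541,14)], [::2]); ([::(263,14)], [::6]); ([::(168,11)], [::5]);
  ([::(422,13)], [::1]); ([::(616,10)], [::616]); ([::(267,13)], [::1]);
  ([::(450,14)], [::6]); ([::(550,11)], [::3]); ([::(290,11)], [::5]);
  ([::(400,14)], [::2]); ([::(354,13)], [::1]); ([::(109,13)], [::1]);
  ([::(484,13)], [::1]); ([::(241,11)], [::3]); ([::(501,11)], [::3]);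
  ([::(433,13)], [::1]); ([::(264,14)], [::6]); ([::(269,14)], [::4]);
  ([::(548,14)], [::2]); ([::(365,11)], [::3]); ([::(201,14)], [::4]);
  ([::(432,13)], [::1]); ([::(136,14)], [::4]); ([::(425,11)], [::3]);
  ([::(174,11)], [::5]); ([::(44,11)], [::5]); ([::(132,11)], [::5]);
  ([::(121,14)], [::6]); ([::(124,11)], [::5]); ([::(197,14)], [::6]);
  ([::(72,11)], [::5]); ([::(26,11)], [::5]); ([::(130,14)], [::6]);
  ([::(599,14)], [::2]); ([::(257,13)], [::1]); ([::(586,14)], [::2]);
  ([::(338,13)], [::1]); ([::(123,11)], [::5]); ([::(310,14)], [::6]);
  ([::(33,14)], [::6]); ([::(270,14)], [::4]); ([::(339,13)], [::1]);
  ([::(544,11)], [::3]); ([::(451,14)], [::6]); ([::(559,13)], [::1]);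
  ([::(318,14)], [::4]); ([::(518,14)], [::2]); ([::(492,11)], [::3]);
  ([::(196,14)], [::6]); ([::(82,11)], [::5]); ([::(326,14)], [::6]);
  ([::(575,11)], [::3]); ([::(254,14)], [::6]); ([::(29,11)], [::5]);
  ([::(291,11)], [::5]); ([::(611,14)], [::2]); ([::(18,10)], [::18]);
  ([::(551,11)], [::3]); ([::(240,11)], [::3]); ([::(43,11)], [::5]);
  ([::(200,14)], [::4]); ([::(316,14)], [::6]); ([::(614,14)], [::2]);
  ([::(577,14)], [::2]); ([::(7,12)], [::7]); ([::(10,11)], [::5]);
  ([::(71,11)], [::5]); ([::(89,14)], [::6]); ([::(352,13)], [::1]);
  ([::(585,14)], [::2]); ([::(424,11)], [::3]); ([::(126,14)], [::4]);
  ([::(219,13)], [::1]); ([::(605,14)], [::2]); ([::(578,14)], [::2]);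
  ([::(342,14)], [::6]); ([::(460,14)], [::4]); ([::(266,13)], [::1]);
  ([::(339,5); (476,5); (318,8); (555,1)], [::476; 555; 318; 186; 90; 72; 175;
  285; 365; 425; 488; 492; 578]); ([::(373,3); (231,7)], [::7; 373]);
  ([::(96,8); (109,4); (93,6); (373,3); (34,2)], [::373; 219; 29; 109; 96;
  34]); ([::(326,12); (200,8); (93,8)], [::200; 93]); ([::(326,6); (241,9);
  (219,8)], [::400; 183; 318; 484; 219; 109; 380; 34; 518; 90; 96; 614; 365;
  186; 333; 570; 205; 459; 488; 476; 469; 466; 511; 541; 339; 529; 558; 578;
  441; 616; 290; 607; 602; 589; 606; 450; 159; 555; 590; 547; 405; 448; 532;
  597; 582; 536; 574; 543; 595; 551]); ([::(518,8); (96,8); (241,9); (219,8);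
  (400,10)], [::518; 269; 326; -139; 200; 93; 109; 373; 34; -137; 219; 132;
  231; 46; 109]); ([::(109,8); (365,2); (373,14); (219,8)], [::365; 219; 290;
  109; 205; 90; 212; 159; 459; 318; 469; 168]); ([::(180,9); (186,2); (90,2);
  (339,9); (34,2); (68,5)], [::186; 90; 34; 318; 68; 180; 109; 10; 205; 241;
  26; 365; 168; 124; 570; 488; 290; 63; 422; 476; 223; 578; 432; 175; 50; 231;
  541; 391; 269; 183; 281; 132; 441; 147; 400; 29; 155; 326; 529; 219; 57; 373;
  61; 363; 303; 122; 532; 420; 406; 527; 481; 473]); ([::(333,2); (484,5);
  (459,2); (159,6); (541,2)], [::333; 459; 159; 541; 219; 290; 257; 318; 518;
  183; 419; 63; 326; 435; 168; 175; 466; 450; 400; 526; 547; 241; 441; 109;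
  269; 405; 144; 285; 272; 112; 135; 377; 127; 200; 93; 29; 155; 14; 58; 38;
  242; 43; 72; 369; 116; 215; 189; 448; 355; 365; 373; -141; 298; 365; 7; 570;
  231; 488; 132; 578; 432; 536; 180; 186; 90; 339; 34; 68; -142; 492; 252; 347;
  359; 268; 259; 356; 423; 203; 188; 500; 207; 205; 193; 493; 282; 539; 287;
  456]); ([::(518,8); (365,2); (96,8); (109,8); (326,8); (219,9)], [::109; 518;
  96; 373; -141; 93; 365; 326; 290; 400; 241; 318; 570; 333; 484; 459; 159;
  541; -143; 529; 476]); ([::(191,10); (61,12); (132,10); (303,9); (122,8);
  (265,10); (376,9); (500,3); (76,9)], [::61; 191; 303; 265; 122; 376; 432;
  256; 186; 76; 500; 493; 130; 420; 190; 197; 346; 254; 263; 124; 273; 365;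
  134; 292; 139; 126; 438; 424; 353; 436; 267; 548; 430; 327; 291; 236; 460;
  54; 160]); ([::(285,1); (290,1); (175,3); (292,1); (144,8); (476,10); (63,6);
  (111,3); (339,12); (210,9); (82,8); (203,8); (61,12)], [::476; 175; 63; 72;
  318; 285; 168; 144; 210; 290; 167; 203; 183; 484; 241; 435; 326; 547; 450;
  400; 441; 109; 280; 219; 34; 101; 419; 293; 90; 170; 526; 186; 471; 207; 482;
  111; 64; 347; 145; 269; 423; 560; 258; 356; 453; 565; 217; 605; 345; 292;
  301; 557; 436; 365; 178; 462; 124; 431; 514; 260; 422; 586; 254; 155; 36;
  337; 147; 249; 158; 255; 264; 191; 132; 303; 122; 265; 376; 500; 76; -145;
  82; 61; 46; 176; 352; 55; 22; 66; 266; 265; 95; 80; 25; 191; 434; 256; 156;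
  166; 199; 131; 77; 410; 500; 197; 125; 45; 401; 548; 274; 84; 21; 389; 327;
  184; 157; 259; 408; 460; 94; 402; 302; 67; 399; 40; 510; 483; 316; 108; 182;
  447; 211; 325; 148; 294; 91; 366; 319; 233; 237; 224; 496; 121; 193; 76]);
  ([::(448,13); (602,5); (323,9); (335,9); (474,9); (425,8); (555,5)], [::323;
  555; 189; 602; 476; 425; 616; 339; 492; 285; 257; 578; 541; 459; 536; 318;
  333; 309; 252; 570; 175; 335; 391; 413; 567; 521; 183; 511; 468; 474; 290;
  241; 260; 338; 419; 365; 529; 349; 421; 526; 124; 400; 259; 422; 471; 188;
  496; 320; 193; 332]); ([::(493,10); (132,8); (231,14); (82,8); (66,5);
  (176,12); (191,9); (423,12)], [::132; 176; 191; 82; 66; 168; 493; 109; 326;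
  266; 318; 199; 400; 186; 269; 255; 432; 423; 352; 339; 257; 488; 422; 541;
  578; 420; 124; 419; 260; 345; 290; 189; 496; 431; 264; 435; 542; 500; 491;
  489; 131; 347; 550; 319; 548; 421; 604; 454; 327; 259; 561; 237; 399; 480;
  227; 316; 470; 387]); ([::(572,12); (531,12); (244,6); (423,14); (496,5);
  (494,6); (491,2); (501,8); (235,6)], [::491; 496; 501; 572; 531; 244; 235;
  326; 494; 433; 547; 541; 421; 489; 338; 493; 577; 540]); ([::(410,10);
  (352,9); (494,6); (231,12); (482,12); (168,2); (257,4); (176,4); (423,12);
  (235,6); (493,10); (531,12); (132,8); (82,8); (419,6); (66,5); (491,2);
  (191,8); (356,12); (496,5); (266,8)], [::266; 410; 257; 419; 168; 290; 435;
  183; 526; 484; 176; 191; -148; 132; 432; 82; 43; 116; 572; 244; 501; -149;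
  496; 345; 482; 356; 269; 347; 493; 500; 547; 433; 541; 270; 318; 401]);
  ([::(205,4); (547,4); (365,10); (175,3); (335,9); (476,10); (63,6); (111,3);
  (124,2); (260,4); (339,8); (210,1); (82,8); (159,1); (61,12); (488,8);
  (432,4); (147,5)], [::124; 205; 260; 241; 147; 285; 290; 292; 144; 210; 203;
  -146; 189; 488; 422; 476; 223; 578; 570; 186; 432; 544; 391; 511; 269; 612;
  400; 518; 529; 459; 484; 290; 614; 183; 159; 596; 435; 405; 219; 526; 547;
  272; 109; 597; 541; 326; 318; 309; 448; 602; 323; 474; 425; 555; -147; 536;
  410; 352; 494; 231; 482; 168; 257; 176; 423; 235; 493; 531; 132; 419; 66;
  491; 191; 356; 496; 266; -150; 82; 266; 501; 132; 135; 550; 496; 357; 191;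
  491; 349; 347; 199; 255; 423; 228; 425; 493; 261; 320; 492; 195; 125; 187;
  330; 366; 193; 340; 229; 345; 321; 390; 472]); ([::(155,8); (200,4); (466,6);
  (175,3); (365,2); (90,10); (29,1); (476,10); (63,6); (93,12); (111,1);
  (124,2); (339,8); (68,12); (210,1); (159,1); (57,2); (488,8)], [::29; 155;
  200; 68; 57; 466; 326; 269; 34; 205; 547; 335; 111; 260; 82; 61; 432; 147;
  -151; 124; 205; 241; 109; 400; 183; 219; 318; 290; 484; 212; 373; 186; 570;
  450; 435; 296; 247; 7; 455; 72; 572; 547; 149; 526; 422; 132; 501; 266; 419;
  254; 46; 82; 352; 550; 191; 36; 345; 432; 199; 77; 496; 431; 265; 500; 193;
  131; 256; 548; 134; 76; 197; 187; 126; 327; 73; 237; 171]); ([::(365,2);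
  (175,3); (90,10); (29,1); (476,10); (518,12); (63,6); (111,1); (124,2);
  (68,8); (210,1); (269,8); (159,1); (57,2)], [::269; 400; 318; 186; 326; 155;
  200; 466; 93; 339; 68; 488; -152; 29; 200; 109; 373; 219; -141; 7; 219; 109;
  484; 33; 357; 183; 231; 32; 241; 86; 168; 247; 34; 290; 176; 15; 118; 501;
  132; 10; 435; 450; 53; 66; 121; 46; 26; 135; 235; 149; 18; 22; 266; 12; 80;
  429; 394; 191; 43; 175; 129; 419; 312; 122; 329; 199; 255; 27; 324; 238; 453;
  72; 363; 77; 496; 170; 19; 85; 178; 181; 136; 356; 65; 55; 436; 264; 95; 345;
  28; 76; 74; 193; 81; 133; 124; 79; 24; 84; 134; 36; 184; 141; 434; 42; 240;
  48; 174; 82; 182]); ([::(326,8); (183,2); (484,1); (90,10); (318,8)], [::318;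
  186; 326; 400; 484; 183; 241; 34; 518; 365; 96; 109; 219; -144; 380; 109;
  175; 29; 476; 63; 111; 124; 68; 210; 269; 159; 57; -153; 459; 269; 614; 541;
  290; 155; 200; 46; 572; 596; 450; 373; 435; 68; 93; 132; 22; 570; 501; 547;
  247; 365; 29; 124; 612; 357; 466; 383; 511; 57; 61; 260; 476; 86; 298; 212;
  142; 391; 422; 339; 439; 350; 296; 103; 496; 347; 379; 111; 433; 258; 356;
  136; 217; 173; 354; 85; 44; 474; 79; 267; 84; 349; 47; 548; 197; 436; 220;
  327; 485; 67; 184]); ([::(93,2); (33,4); (132,10); (231,12)], [::231; 33; 93;
  11; 373; 7; 219; 109; 46; 400; 22; 326; 572; 318; 200; 501; 35; 247; 357;
  406; 484; 183; 532; 66; 86; 290; 241; 114; 29; 459; 34; 380; 213; 61; 159;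
  90; 383; 352; 162; 212; 155; 221; 303; 217; 296; 379]); ([::(365,2); (200,2);
  (93,2); (46,5); (124,2); (212,7); (132,1)], [::350; 365; 124; 132; 46; 269;
  200; 93; 11; 219; 35; 357; 118]); ([::(365,10); (511,4); (459,4); (422,1);
  (124,2)], [::124; 422; 241; 260; 511; 459; 518; 400; 269]); ([::(200,2);
  (93,2); (373,9); (132,9)], [::373; 93; 200; 219; 269; 29; 518; 46; 380; 109;
  11; 96; 35; 34]); ([::(241,9); (380,1)], [::380; 518; 96; 219; 400; -140;
  109; 365; -141; 326; -144; 109; 34; 183; 484; 90; 318; -154; 318; 326; 186;
  93; 33; 231; -155; 200; 46; 124; 212; -156; 339; 511; 459; 422; -157; 373;
  -158; 46; 269; 200; 518; 93; 373]); ([::(93,10); (373,9); (219,1); (484,1);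
  (290,8)], [::373; 219; 290; 518; 484; 365; 558; 90; 459; 511; 159; 212]);
  ([::(93,8); (373,9); (219,1); (484,1); (290,8)], [::-160; 373; 219; 518; 29;
  484; 326; 400; 183; 109; 318; 290; 66; 168; 63]); ([::(326,8); (93,8);
  (247,10); (373,11)], [::7; 247; 93; 326; 200; 501; 572; 484; 219; 183; 29;
  333; 241; 96; 380]); ([::(93,8); (247,10); (183,2); (373,9); (219,1);
  (290,8)], [::-161; 183; 326; -162; 93; 290; 219; 326; 435; 365; 518; 200; 90;
  400; 501; 269; 135; 466; 53; 318; 155; 352; 247; 550; 305; 235; 186; 455;
  406; 432; 166; 296; 277; 590; 132; 159; 59; 529; 303; 512; 212; 140; 422;
  376; 450; 511; 339; 202; 547; 459; 493; 541; 500; 347; 496; 199; 354; 489;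
  549; 434; 191; 267; 421; 424; 77; 329; 256; 170; 187; 471; 320]);
  ([::(365,2); (373,1); (124,2); (132,3)], [::124; 365; 241; 380; -159; 247;
  183; 373; 219; 290; -163; 219; 373; 518; 290; 400; 183; 231; 269; 326; 505;
  484; 109; 155; 200; 318; 254; 529; 34; 455; 466; 168; 422; 296; 68; 589; 432;
  212; 172; 331; 590; 550; 339; 247; 558; 501; 72; 238; 285; 496; 175; 555;
  193; 63; 456; 257; 507]); ([::(183,2); (373,11); (219,1)], [::7; 219; 518;
  93; 380; 29; 183; 241; 326; 247; 484; 200; 572; 501]); ([::(365,2); (183,2);
  (373,1); (124,2); (132,1); (219,1)], [::-164; 373; -165; 7; 219; 231; 518;
  93; 109; 400; 326; 484; 183]); ([::(326,8); (93,12); (373,14)], [::326; 200;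
  501; 572; 7; 484; 357; 219; 29; 86; 183; 290; 435; 365; 450; 526; 90; 558;
  547; 205; 459; 592; 469; 109; 149; 541; 318; 394; 168; 33; 266; 213; 570;
  186; 400; 477; 63; 231; 257; 488; 155; 144; 360; 523; 223; 339; 286; 358;
  203; 361; 207]); ([::(518,12); (511,8); (269,8); (159,10); (260,8); (212,10);
  (391,12)], [::269; 260; 400; 391; 511; 212; 459; 159; 219; 380; 241; 365;
  124; 183; 373; -165; 290; 326; 93; -167; 90; 326; 155; 318; 200; 186; 501;
  339; 422; 432; 352; 585; 547; 466; 166; 519; 221; 406; 383; 277; 247; 162;
  142; 97; 61; 381; 303; 29; 298; 376; 183; 456; 214; 435; 193; 266; 439; 257;
  354; 268]); ([::(134,9); (354,4); (339,8); (193,9); (347,3); (257,8);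
  (159,11); (356,3); (496,10); (434,10)], [::257; 339; 347; 356; 354; 269; 434;
  134; 496; 193; 84; 423; 422; 200; 268; 267; 491; 435; 260; 124; 501; 259;
  188; 132; 252; 326; 93; 247; 373; -162; 219; 518; 400; 241; 365; 183; 380;
  290; 459; 297; 425; 349; 436; 270; 424; 440; 433; -167; 326; 155; 90; 466;
  318; 217; 207; 212; 376; 541; 175; 345; 511; 292; 301; 489; 285; 264; 300;
  293; 540; 448; 399; 430; 377; 367; 316; 536; 291; 369; 359; 327; 387; 174;
  127; 492; 475; 237; 416; 227; 522]); ([::(422,1); (175,10); (318,10);
  (529,3); (400,2)], [::175; 400; 241; 326; 529; 183; 422; 484; 124; 365; 90;
  186; 72; 285; 373; 219; -165; 132; -166; 247; 290; 406; 459; 435; 541; 558;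
  425; 450; 547; 266; 466; 518; 511; 269; 159; 260; 212; 391; -168; 269; 219;
  260; 93; 189; 155; 200; 296; 501; 277; 134; 354; 339; 193; 347; 257; 356;
  496; 434; -169; 257; 193; 127; 121; 339; 456; 268; 349; 134; 135; 129; 492;
  376; 354; 210; 496; 293; 347; 502; 379; 363; 489; 549; 77; 356; 248; 238;
  493; 125; 217; 332; 329; 366; 233; 482; 191; 571; 409; 319; 586; 403; 581]);
  ([::(518,8); (269,8); (400,10)], [::269; 518]); ([::(134,1); (93,8); (183,2);
  (422,1); (373,14); (529,2); (484,12)], [::183; 290; 365; 435; 326; -167; 219;
  90; 326; 200; 518; 269; 400; -171; 318; 459; 186; 541; 425; 175; 529; -170;
  72; 124; 339; 134; 257; 193]); ([::(268,8); (257,8); (456,9); (421,1);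
  (193,9); (474,6); (376,9); (292,8); (210,12); (349,13)], [::193; 210; 456;
  257; 474; 376; 425; 268; 315; 338; 292; 200; 421; 293; 259; 270; 340; 156;
  551; 347; 217; 332; 543; 433; 424; 301; 599; 354; 290; 431; 560; 267; 435;
  419; 352; 471; 256; 348; 356; 168; 526; 7; 345; 494; 278; 482; 405; 107; 430;
  264; 163; 401; 235; 291; 399; 93; 318; 513; 326; 541; 451; 234; 489; 150;
  178; 540; 114; 418; 213; 120; 342; 130; 262]); ([::(268,8); (456,9); (193,9);
  (435,10); (376,9); (210,12); (425,2); (217,3); (521,5); (293,12); (517,3);
  (421,1); (474,4); (292,8); (349,1)], [::425; 521; 257; 474; 349; -173; 193;
  456; 376; 517; 293; 217; 210; 301; 292; 509; 290; 374; 133; 270; 348; 356;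
  259; 436; 188; 421; 125; 258; 433; 261; 426; 496; 341; 548; 345; 491; 500;
  267; 424; 199; 540; 351; 316; 430; 327; 451; 291; 460; 559]); ([::(326,8);
  (93,10); (529,2); (219,1); (484,1); (459,2)], [::326; 219; 200; 484; 518;
  269; 400; -171; 318; 529; 459; 241; 558; 333; 541; 380; 469; 609; 290; 96;
  575; 598; 570; 168; 373; 34; 614; 365; 572; 419; 501; 90; 518; 124; 526; 7;
  357; 155; 186; 466; 269; 488; 441; 132; 285; 247; 413; 383; 406; 519; 277;
  268; 456; 193; 435; 376; 210; 425; 217; 521; 293; 517; 421; 474; 292; 349;
  -174; 425; 183; 547; 257; 450; 266; 339; 193; 352; 149; 429; 394; 347; 268;
  199; 187; 345; 66; 354; 340; 351; 176; 434; 430; 105; 424; 43; 291; 216]);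
  ([::(326,8); (93,8); (529,2); (484,1); (219,1); (501,1); (572,1); (459,2)],
  [::-175; 326; 484; 200; 572; 501]); ([::(134,1); (93,8); (422,1); (183,2);
  (373,14); (529,2); (435,2); (459,2)], [::-172; 219; 501; 572; -176; 183; 484;
  435; 572; 501]); ([::(373,14); (219,8); (400,6)], [::219; 518; 109; 269; 241;
  365; 205; 90; 318; 93; 326; 200]); ([::(365,2); (183,2); (124,2); (219,1);
  (132,1)], [::-166; 365; 290; 124; 241; 134; 422; 529; 435; 459; -177; 219;
  400; -178; 326; 505; 318; 254; 168; 459; 422; 469; 589; 205; 511; 529; 558;
  109; 212; 484; 450; 231; 296; 183; 512; 223; 172; 247; 406; 314; 238; 396]);
  ([::(93,6); (373,1); (260,8); (219,1); (400,2); (290,1)], [::219; 373; 290;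
  518; 365; 400; 269; 326; 155; 260; 450; 183; 511; 558; 484; 212; 590; 296;
  589; 529; 422]); ([::(365,2); (422,9); (183,2); (254,8); (219,1)], [::254;
  124; -179; 432; 124; 260; 365; 269; 241; 400; 505; 518; 529; 155; 205; 373;
  -165; 7; 219; 247; 290; 231; 109; 484; 93; 532; 450; 360; 36; 183; 326; 200;
  90; 303; 119; 435; 547; 466; 186; 51; 298; 339; 286; 347; 455; 356; 464; 500;
  381; 371]); ([::(326,8); (93,8); (219,9)], [::93; 326; 200; 373; -167; 518;
  400; 269; 109; 155; 241; 365; 124; 57; 96; -144; 34; 29; 90; 212; 27]);
  ([::(365,2); (183,2); (124,2); (219,1); (400,6)], [::254; -181; -179; 124;
  422; 365; 241; 529; 373; -165; 260; 290; -180; 326; -182; 373; 484; 290;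
  183]); ([::(241,9)], [::380; -159; 365; 183; 124; 219; -179; 124; 365; 373;
  260; 400; 290; -180; 422; 254; -181; -183; 254; 529; 505; 205; 36; 109; 219;
  484; 93; 183; 326]); ([::(326,6); (183,2); (373,1); (219,1)], [::183; 484;
  241; 219; 29; 93; 96; 373; 200; 34; 518; 247; 290; 572; 90; 400; 269; 466;
  435; 501; 406; 318; 132; 298; 547; 277; 186; 432; 82; 439; 352; 138; 354;
  266; 197; 191]); ([::(183,2); (373,1); (219,5)], [::373; -185; -165; 93; 518;
  326; 200; 400; 269; 501; 241; 318; 155; 550; 352; 109; 365; 183; 455; 432;
  231; 124; 90; 66; 175; 331; 223; 34; 186; 63; 180; 68; 32; 234; 103; 111]);
  ([::(183,2); (373,1); (219,5)], [::-186]); ([::(93,8); (183,2); (373,1);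
  (219,1)], [::-187; 93; 373; 518; 326; -185; 400; 109; 241]); ([::(326,10);
  (93,8); (219,1)], [::93; -182; 373; -167; 518; 380; 400; 241]); ([::(373,1);
  (219,5); (400,10)], [::518; 109; 269; 373; 241; 7; 93; 231; 29; 132; 183;
  247]); ([::(109,4); (46,12); (124,2); (241,1); (132,8)], [::109; 124; 46;
  132]); ([::(373,1); (219,1); (400,10); (318,8)], [::318; 326; -190; 93; 484;
  373; 200; 183; 518; 7; 290; 466; 269; 572; 168; 365; 435; 155; 501; 419; 505;
  305; 526; 455; 247; 352; 235; 109; 46; 124; 132; -191; 380; 383; 221; 114;
  99; 406; 335; 486; 563; 334; 298; 244; 381; 178; 464; 431; 514; 345; 557]);
  ([::(93,8); (373,1); (219,9)], [::93; 373; 518; 326; -189; 400; 318; -192]);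
  ([::(93,8); (373,1); (219,1)], [::-193; -189; 373; -188; 326; 29; 400; 318;
  -192; 318; 518; 269; 373; 93; 132; 155; 200; 432; 466; 82; 352; 298; 213;
  501; 166; 286; 435; 247; 221; 290; 406; 31; 365; 217; 512; 61; 241; 205; 207;
  450; 162; 175; 124; 347; 547; 72; 57; 266; 27; 191; 212; 95; 339; 214; 422;
  289; 281]); ([::(572,2); (326,6); (200,4); (357,1); (484,1)], [::484; 200;
  572; 357; 501]); ([::(93,8); (373,13); (400,4)], [::93; 219; -194; 572; 326;
  200; 357; 484; -195; 400; 109; 518; 231; 269; 132; 46]); ([::(326,8);
  (93,10); (373,3)], [::326; 373; 200; 219; 7; 572; 501; 357; 484; 183; 241;
  400; 109]); ([::(33,2); (400,6); (318,4)], [::241; 318; 109; 326; 33; 93;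
  200; 219; -189; 484; 29; 183; 333; 459; 96; 541; 290; 34; 435; 558; 168; 90;
  547; 469; 63; 419; 53; 155; 186; 205; 66; 257; 526; 235; 121; 365; 18; 405;
  494; 15; 124; 505; 149; 8; 507; 32; 254; 266; 213; 17; 223; 62; 352; 114; 16;
  488; 107; 127; 339; 345; 369; 422; 490; 496; 423]); ([::(326,8); (93,8);
  (373,3)], [::-197; 326; 200; -189; 484; 29; -136; 33; 400; 318; -198; 269;
  318; 518; 90; 373; 380; 231; 96; 168; 333; 412; 183; 459; 335; 290; 241; 541;
  53; 435; 247; 109; 235; 501; 185; 439; 181; 238; 433; 496]); ([::(518,2);
  (93,12); (269,2); (373,3)], [::326; -199; 200; 269; 518; 400; 373; 318; 7;
  219; 90; 231; 29; 484; 132; 46; 109; 241; 365; 124; 529; 183; 247; 290; 212;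
  254; 333; 86; 61; 435; 296; 263; 459; 305; 162; 466; 159; 303; 166; 376;
  95]); ([::(93,8); (373,1); (400,4)], [::-196; -194; -199; 400; 231; -136;
  518; 269; -200; 373; 200; 518; 7; 501; 269; 231; 155; 550; 132; 455; 247; 46;
  406; 109; 277; 241; 114; 331; 365; 124; 213; 192; 481; 223; 254; 267; 180;
  263; 256; 234; 41; 344; 120; 75]); ([::(367,4); (529,13); (404,12); (379,6);
  (329,6); (238,6); (296,5); (234,12); (191,6); (293,9)], [::296; 379; 238;
  367; 329; 293; 404; 191; 219; 234; 453; 225; 376; 318; 186; 90; 326; 93; 373;
  -199; 484; 400; 109; 409; 241; 170; 365; 183; 77; 124; 505; 247; 333; 223;
  254; 441; 331; 373; 459; 315; 155; 363; 411; 290; 7; 541; 455; 496; 558; 168;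
  301; 489; 549; 506; 178; 84; 421; 586; 256; 232; 431; 502; 267; 133; 499;
  354; 436; 548; 375; 197; 302; 573; 327; 184; 485]); ([::(376,3); (379,6);
  (296,5); (186,2); (234,12); (90,6); (95,1); (367,4); (529,5); (404,12);
  (329,6); (238,6); (191,2); (293,9); (303,5)], [::186; 318; 191; -202; 296;
  616; 400; 241; 303; 326; 155; 109; 365; 376; 183; 124; 95; 292; 293; 57; 13;
  61; 29; 132; 231; 269; 168; 518; 290; 380; 466; 301; 435; 456; 305; 166; 86;
  373; 219; -192; 46; 484; 212; 25; 558; 333; 606; 476; 159; 22; 200; 459; 405;
  53; 335; 135; 541; 377; 14; 332; 248; 602; 304; 27; 320; 582; 80; 72; 404;
  551; 77; 391; 234; 329; 433; 502; 85; 511; 134; 201; 436; 583; 84; 354; 270;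
  350; 184; 47; 30; 220]); ([::(231,12); (376,3); (379,6); (296,5); (186,2);
  (234,8); (192,12); (367,4); (529,5); (132,9); (404,12); (329,6); (238,6);
  (293,9); (61,12); (303,5)], [::231; 61; 192; 124; 241; 365; 223; 234; 90; 95;
  191; -203; 186; 318; 488; 168; 570; 339; 290; 422; 476; 212; 296; 529; 303;
  589; 400; 376; 558; 511; 254; 269; 326; 293; 555; 459; 391; 183; 93; 301;
  541; 448; 578; 435; 200; 257; 189; 266; 193; 191; 187; 496; 258; 134; 256;
  542; 84; 265; 548; 319; 197; 327]); ([::(352,4); (231,12); (376,3); (379,4);
  (296,5); (186,2); (234,8); (192,12); (383,12); (367,4); (529,5); (132,8);
  (404,4); (329,6); (501,10); (331,5); (238,6); (293,9); (61,12); (550,8);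
  (486,6)], [::352; 383; 550; 486; 331; 221; 241; 247; 380; 219; 379; 404; 303;
  -204; 231; 61; 432; 82; 29; 303; 269; 200; 185; 183; 376; 400; 335; 86; 326;
  248; 25; 484; 409; 166; 404; 410; 329]); ([::(373,7); (135,4)], [::7; 93;
  -201; 518; 269; 326; -199; 318; 219; -194; 109; 484; 380; 241; 365; 183; 124;
  505; 290; 333; 29; 247; 254; 435; 558; 459; 412; 155; 135; 541; 466; 455;
  200; 377; 335; 93; 352; 231; 376; 379; 296; 186; 234; 192; 383; 367; 529;
  132; 404; 329; 501; 331; 238; 293; 61; 550; 486; -205; 572; 383; 357; 550;
  570; 608; 99; 432; 488; 476; 594; 450; 35; 422; 607; 223; 529; 547; 441; 114;
  496; 555; 296; 493; 221; 180; 549; 434; 363; 379; 500; 420; 234; 329; 453;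
  217; 467; 371; 542; 134; 245; 404; 356; 201; 548; 265; 130; 391; 271; 354;
  197; 511; 260; 347; 327; 448; 191; 189; 319]); ([::(365,3); (186,2); (90,2)],
  [::241; 90; 124; 186; 72; 318; 339; 570; 488; 476; 578; 175; 541; 285; 441;
  555]); ([::(93,8); (186,2); (90,10)], [::93; 186; 318; -207; 33; 400; -198;
  326; 254; 200; 505; 205; 109; 365; 241; 34; 124; 183; 10; 29; 96; 86; 219;
  333; 484; 212; 459; 350; 476; 541; 159; 511; 357; 570; 562; 339; 405; 22;
  391; 589; 469; 297; 578; 488; 422; 257; 25; 80; 425; 58; 223; 520; 193; 46;
  127; 315; 268; 332; 134; 187; 496; 79; 234; 137; 320; 456; 568; 349; 173;
  404; 376; 443; 437; 228; 111; 256; 493; 543; 238; 388; 120; 581; 427; 363;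
  245; 181; 396; 361; 506; 128; 117; 85; 324; 371; 385; 207; 69; 199; 314; 217;
  133; 231; 356; 240; 132; 270; 375; 269; 47; 258; 220; 267; 354]);
  ([::(405,5); (320,5); (332,7)], [::405; 320]); ([::(608,12); (572,12);
  (489,9); (450,8); (501,9); (496,9)], [::496; 572; 489; 608; 541; 450; 549;
  547; 326; 484; 200; 93; 466; 373; 219; -194; 29; 357; 350; 400; -201; 318;
  109; 459; 441; 570; 241; 476; 594; 607; 365; 183; 529; 505; 488; 124; 333;
  422; 254; 223; 335; 434; 135; -206; 7; 247; 538; 329; 238; 186; 90; -208;
  186; 212; 155; 339; 296; 455; 172; 57; 379; 550; 225; 13; 367; 467; 46; 201;
  405; 320; 332; -209; 248; 456; 181; 376; 446; 539; 245; 303; 493; 322; 534;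
  432; 292; 500; 540; 307; 420; 286; 433; 188; 122; 542; 527; 180; 316; 363;
  130; 535; 548; 234; 451; 447; 89; 452; 568; 453; 308; 436; 134; 442; 593;
  474; 293; 265; 84; 193; 537; 349; 77; 197; 133; 311; 425; 341; 94; 327; 125;
  492; 426; 375; 184; 399; 366; 233; 294; 457; 485; 302; 229; 571; 224; 211;
  528; 325; 475; 321; 470; 362; 218; 569; 319; 483; 525; 472; 403; 313; 402;
  392; 157; 508; 146; 444]); ([::(118,5); (357,5); (373,11); (247,3)], [::7;
  247; 118; 241; 357; 183; 219; 350; 29; 484; 93; 333; 326; 200; 400; -201;
  318; 109; 459; 541; 365; 186; 90; -207; 505; 124; 254; -208; 212; 155; 186;
  455; 488; 441; 296; 339; 570; 538; 529; 422; 616; 172; 589; 238; 555; 329;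
  607; 608; 572; 489; 450; 501; 496; -210; 435; 550; 549; 352; 606; 544; 496;
  432; 600; 489; 578; 493; 581]); ([::(373,7); (135,4)], [::-206]);
  ([::(357,5); (373,3); (135,4); (247,3); (46,9); (118,1); (13,9)], [::-212; 7;
  247; 241; 183; 118; -211; 46; 13; 22; 132; 109; 231; 219; 400; 29; 269; 93;
  200; 9; 25]); ([::(93,8); (373,3)], [::-201; 326; -199; 318; -194; 109; 484;
  241; 183; 333; 459; 541; 365; 186; 90; -207; 124; 254; -208; 212; 155; 186;
  441; 357; 247; 46; 118; 13; -213; 235; 200; 53; 269; 93; 357; 466; 159; 33;
  373; 501; 350; 335; 405; 290; 231; 32; 7; 247; 435; 272; 332; 168; 132; 223;
  103; 419; 266; 552; 248; 456; 320; 191; 257; 553; 376; 193; 170; 255; 329;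
  502; 268; 234; 77; 293; 125; 178; 409; 354; 437; 285; 133; 431; 243; 347;
  425; 175; 499; 493; 230; 375; 492; 366]); ([::(93,8); (373,3)], [::-214]);
  ([::(93,8); (373,1)], [::-215; 93; -201; 518; 269; 219; 200; 109; 326; 501;
  241; 231; 318; 550; 352; 183; 365; 132; 168; 90; 432; 290; 484; 247; 435;
  124; 505; 186; 212; 590; 558; 333; 572; 331; 135; 254; 589; 450; 459; 526;
  477; 422; 155; 511; 547; 541; 419; 213; 469; 563; 455; 391; 585; 266; 496;
  512; 598; 192; 404; 191; 257; 461; 580; 256; 122; 255; 265; 193; 196; 267;
  546; 125; 258; 540; 325; 188; 316]); ([::(518,6); (93,8)], [::373; -216; 219;
  93; 326; -189; 484; 200; 183; 269; 290; 400; 558; 318; 459]); ([::(93,8);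
  (200,8); (269,8)], [::-217; -216; 219; -189; -138; 400; -171; 518; 269]);
  ([::(326,8); (93,10)], [::326; 200; 373; -199; -217; -216; 219; 501; 269;
  400; -171; 318; 241; 183; 380; 109; 247; 435; 175; 290; 518; 66; 231; 406;
  305; 425; 365; 466; 269; 63; 132; 297; 541; 205; 90; 124; 46; 277; 155; 168;
  159; 34; 186; 26; 254; 36; 11; 51; 223; 257; 212; 68; 72; 441; 263; 18; 50;
  339; 193; 103; 476; 20; 285; 347; 134; 187; 456; 268; 111; 555; 144; 354;
  258; 423; 234; 434; 376; 37; 560; 88; 267; 125; 120; 42; 293; 152; 188; 256;
  77; 19; 191; 153; 23; 265; 493; 398; 89; 161; 546; 92; 325]); ([::(200,6)],
  [::326; 93; -182; -199; -216; 219; 501; -219; 326; 29; 484; 357; 86; 183;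
  290; 241; 450; 365; 558; 547; 459; 541; 318; 441; 175; 285]); ([::(93,8);
  (269,8)], [::-218]); ([::(365,1); (269,8); (357,1); (484,1); (400,12)],
  [::269; 518; 200; 93; -221; 326; 155; 484; 318; 466; 357; 566; 219; 29; 183;
  241; 86; 109; 365; 57; 305; 34; 373; 570; 90; 290; 124; 68; 455; 247; 7; 572;
  469; 212; 186; 435; 298; 296; 412; 132; 488; 231; 614; 558; 350; 72; 547;
  166; 532; 432; 61; 46; 339; 223; 168; 606; 80; 597; 303; 493; 550; 180; 142;
  95; 22; 347; 419; 574; 376; 234; 500; 539; 420; 156; 201; 356; 423; 581; 258;
  595; 527; 456; 134; 245; 136; 255; 542; 401; 436; 193; 126; 270; 426; 349;
  548; 267; 345; 188; 77; 259; 260; 430; 264; 341; 84; 40; 422; 130; 399; 184;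
  495; 108; 302; 236; 211; 368; 294]); ([::(365,1); (269,8); (357,1); (484,1);
  (400,4)], [::-222; 241; 109; -221; 33; 219; 231; 29; 183; 484; 326; 200; 269;
  132; 46]); ([::(365,1); (219,12); (400,4)], [::357; 484; -223; 400; 518; 373;
  -201; 326; 373; 29; 484; 365; 183; 290]); ([::(400,6)], [::241; 109; 365;
  219; -224; 380; 518; 269; 200; 326; 93]); ([::(183,1); (373,14); (357,6);
  (484,4); (66,8); (501,2)], [::501; 357; 484; 183; 290; 326; 435; 66; 450;
  149; 547; 266]); ([::(109,12); (231,10); (365,1); (318,6)], [::231; 241; 400;
  7; 365; 326; 373; 570; 90; 124; 200; 572; 290; 469; 488; 205; 186; 223; 501;
  93; 450; 526; 558; 505; 72; 336; 155; 219; 547; 254; 512; 589; 441; 339; 518;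
  592; 406; 616; 285; 212; 269; 613; 606; 144; 555; 350; 277; 585; 203; 63;
  468; 607; 207; 257; 386; 471; 554; 347; 193; 315; 337; 388; 598; 258; 268;
  187; 234; 539; 397; 188; 354; 320; 493; 317; 580; 479; 343; 499; 581; 540;
  329; 546; 601; 316; 239; 191; 325; 447; 89; 183; 395; 457; 435; 508; 470;
  375; 425; 559; 398; 366; 220; 340; 153; 233; 211; 579; 294; 392; 454; 403;
  516]); ([::(365,1); (269,8); (231,8); (400,4)], [::269; 518; 200; 219; -224;
  93; 326; 155; 318; 109; 231; -227; 241; 183; 373; 357; 484; 66; 501; -226;
  365; 124; 455; 505; 290; 260; 205; 168; 213; 469; 36; 26; 310; 13; 450; 51;
  46; 149; 441; 50; 231; 132; 18; 523; 432; 66; 286; 422; 63; 281; 144; 363;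
  88]); ([::(99,10); (63,1); (410,10); (183,8); (435,8); (329,2); (35,10);
  (247,11); (144,9); (318,6); (266,8)], [::35; 329; 99; 410; 238; 200; 401;
  266; 326; 435; 93; 400; 183; 547; 290; 484; 241; 466; 450; 597; 335; 149;
  614; 553; 185; 144; 518; 116; 298; 486; 63; 269; 43; 429; 334; 175; 109; 257;
  155; 215; 406; 112; 205; 219; 425; 38; 152; 277; 505; 357; 348; 72; 88; 207;
  163; 268; 254; 501; 270; 193; 214; 347; 354; 352; 439; 259; 496; 287; 196;
  585; 433; 340; 434; 345; 422; 423; 456; 263; 264; 424; 209; 431; 339; 315;
  343; 162; 399; 104; 154; 106; 291; 252; 539; 253; 351; 151; 510; 216; 545;
  387; 113; 396; 460; 206; 110; 499; 395; 177; 580; 375; 169; 584; 508; 516;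
  392; 378; 403; 366; 233]); ([::(109,8); (373,1); (219,1); (231,10)], [::-216;
  219; 109; 373; 231; 241; 518; 400; 7; 365; 269; 326; 290; 124; 155; 200; 572;
  318; 450; 223; 57; 466; 484; 570; 608; 547; 298; 488; 558; 186; 609; 469; 90;
  617; 310; 611; 205; 34; 614; 505; 336; 96; 597; 441; 254; 576; 531; 384; 393;
  263; 162; 214; 479; 99; 63; 410; 183; 435; 329; 35; 247; 144; 266; -229; 61;
  132]); ([::(269,8); (231,8); (400,4)], [::269; 518; 200; 231; -228; 241; 124;
  260; 93; -221; 326; 155; 466; 318; 57; 570; 109; 373; 219; -230; 109; 484;
  29; 380; 205; 34; 231; 33; 357; 572; 183; 36; 505; 68; 90; 168; 132; 87; 566;
  501; 86; 254; 611; 360; 186; 290; 26; 176; 61; 432; 82; 310; 610; 435; 305;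
  62; 441; 450; 526; 477; 66; 180; 352; 422; 550; 25; 547; 20; 306; 592; 419;
  563; 166; 286; 213; 585; 544; 266; 394; 345; 95; 455; 512; 114; 191; 312;
  337; 557; 496; 431; 265; 156; 314; 406; 107; 493; 199; 453; 324; 482; 514;
  434; 349; 131; 256; 178; 44; 500; 396; 465; 449; 409; 471; 197; 540; 28; 21;
  433; 580; 545; 586; 170; 274; 546; 157; 270; 548; 70; 457; 402; 408; 327; 74;
  483; 343; 182; 351; 299; 584; 288; 603; 524; 478]); ([::(347,7); (268,2);
  (354,1); (191,3); (193,2); (76,9); (131,8)], [::191; 354; 268; 131; 76; 197;
  193; 267; 257; 199; 339; 276; 133; 266; 433; 123; 84; 435; 77; 439; 423; 501;
  125; 352; 188; 274; 259; 264; 40; 399; 108; 316; 211; 89]); ([::(109,8);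
  (219,12); (231,3); (347,4)], [::109; 231; 400; 33; 7; 373; 132; 365; -224;
  205; 290; 241; 505; 87; 34; 124; 247; 450; 254; 90; 223; 36; 318; 155; 93;
  186; 100; 326; 570; 29; 488; 384; 484; 200; 547; 183; 143; 572; 82; 466; 435;
  501; 526; 185; 298; 439; 347; 268; 354; 191; 193; 76; 131; -232; 471; 339;
  482; 578; 422; 423; 181; 486; 541; 529; 281; 433; 115; 352; 409; 496; 594;
  286; 354; 214; 500; 491; 238; 434; 345; 455; 268; 162; 536; 328; 265; 192;
  263; 277; 543; 548; 197; 75; 351; 406; 259; 327; 344; 399; 556; 481; 480;
  604]); ([::(205,9); (149,10); (213,10)], [::149; 213]); ([::(191,13);
  (339,8); (149,10); (570,1); (318,6)], [::570; 186; 339; 90; 476; 488; 212;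
  365; 7; 241; 34; 124; 109; 223; 254; 219; 103; 422; 93; 63; 391; 260; 373;
  257; 147; 231; 290; 121; 155; 132; 419; 296; 247; 526; 529; 329; 235; 484;
  405; 53; 410; 149; 266]); ([::(347,12); (250,9); (207,9); (186,10); (289,10);
  (281,10); (147,9)], [::250; 147; 281; 289; 207; 347; 339; 203; 205; 90; 365;
  318; 488; 570]); ([::(250,9); (363,3); (289,2); (286,9); (193,2); (347,4);
  (453,3); (53,8); (207,9); (191,3); (159,12); (187,2); (149,10); (213,10);
  (147,9); (266,9)], [::191; 149; 453; 213; 363; 286; 205; 347; 186; 289; 281;
  -236; 90; 255; 250; 318; 53; 147; 338; 254; 256; 135; 93; 159; 290; 155; 187;
  257; 219; 121; 193; 210; 109; 235; 124; 199; 241; 365; 133; 373; 570; 518;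
  526; 405; 332; 320; 329; 95; 401; 270; 156; 456; 509; 443; 445; 577; 506;
  455; 491; 207; 192; 214; 217; 289; 267; 152; 345; 281; 163; 264; 496; 422;
  215; 197; 548; 339; 377; 542; 327; 540; 488; 466; 463; 460; 316; 7; 298; 454;
  399; 287; 364; 387; 433; 510; 504; 421; 588]); ([::(365,10); (318,6);
  (450,4); (260,4); (223,8)], [::241; 570; 124; 260; 223; 488; 7; 373; -216;
  373; 290; 450; 326; 200; 547; 400; 269; 466; 391; 155; 298; 231; -231; 132;
  82; 432; 109; 219; 347; -233; 109; 205; 149; 213; -234; 36; 505; 254; 441;
  191; 339; -235; 250; 363; 289; 286; 193; 453; 53; 207; 159; 187; 147; 266;
  -237; 435; 43; 352; 149; 429; 183; 215; 196; 585; 144; 419; 484; 185; 263;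
  604; 63; 152; 526; 345; 572; 486; 162; 257; 453; 88; 163; 265; 76; 501; 482;
  214; 268; 191; 193; 439; 409; 181; 343; 347; 131; 134; 404; 433; 351; 121;
  234; 304; 216; 480; 129; 493; 293; 110; 77; 233; 179]); ([::(326,2); (373,1);
  (231,7); (432,4); (318,2)], [::7; 373; 132; 432; 93; -216; 326; 400; 269;
  109; 219; 347; -233; 109; 241; 365; 318; 450; 260; 223; -238]); ([::(326,2);
  (373,1); (432,4)], [::-216; 326; 400; 373; 318; -239; 269; -231; 432; 518;
  132; 373]); ([::(269,8); (400,4)], [::269; 518; 200; 231; -231; 7; 93; -221;
  326; 318; 109; 219; 347; -233; 109; 241; 365; 450; 260; 223; -238; 373; 570;
  90; 124; 501; 290; 469; 488; 205; 186; 572; 450; 523; 558; 505; 526; 310;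
  547; 432; 477; 589; 441; 592; 422; 520; 306; 394; 339; 312; 468; 471]);
  ([::(326,2); (200,2); (90,8); (318,2)], [::326; 318; 93; 90]); ([::(93,2);
  (90,8); (373,14); (219,4)], [::219; 93; 90; 200; 365; 326; 290; 241; 183]);
  ([::(90,8); (400,4)], [::326; 318; -242; 269; -241; 518; 93; 373; 219; -243;
  432; -240; -216; 219; 326; 373; 29; 484; 318; 132; 183; 357; 572; 614; 459;
  82; 290; 241; 501; 570; 333; 541; 352; 435; 159; 450; 365; 247; 109; 124;
  213; 547; 185; 205; 34; 231; 149; 266; 466; 505; 90; 523; 223; 53; 135; 335;
  597; 298; 254; 186; 286; 469; 590; 488; 235; 272; 553; 439; 263; 422; 191;
  336; 512; 181; 279; 339; 496; 343; 556; 433; 347; 500; 604; 270; 354; 351;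
  268; 264; 480; 259; 399]); ([::(155,10); (200,4); (93,8); (456,3); (509,4);
  (210,12); (207,10)], [::93; 326; 155; 207; 269; -218; 373; -216; 132; 219;
  501; 247; 90; -243; 365; 290; 217; 210; 285; 156; 293; 456; 509; 518; 459;
  466; 400; 318; 376; 166; 406; 186; 541; 292; 301; 95; 298; 277; 441; 284;
  300; 221; 61; 555; 352; 162; 560; 432; 82; 214; 347; 263; 138; 354; 152; 289;
  424; 435; 254; 439; 267; 163; 158; 425; 356; 345; 185; 44; 98; 256; 199; 349;
  265; 83; 222; 192; 193; 270; 514; 275; 139; 115; 198; 258; 268; 133; 48; 273;
  464; 420; 259; 433; 24; 452; 430; 264; 181; 164; 548; 291; 399; 85; 153; 327;
  513; 136; 451; 246; 463; 60; 161]); ([::(435,10); (400,4); (347,12)], [::347;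
  -244; 318; 186; 326; 183; 290; 459; 541; 441; 425; 285; 269; -241; 518; 356;
  466; 93; 373; -201; 365; 132; 219; 29; 155; 456; 509; 210; 207; -245; 86; 93;
  305; 166; 298; 25; 66; 82; 109; 9; 266; 352; 241; 18; 199; 432; 124; 247;
  149; 263; 422; 406; 53; 162; 277; 159; 519; 257; 381; 339; 464; 258; 455;
  267; 192]); ([::(347,12); (400,4)], [::-246; -244; 318; 326; 186; 269; -241;
  518; 93; 373; -201; 365; 290; 435; 459; 347; 183; 541; 241; 425; 124; 257;
  72; 339]); ([::(400,4); (347,12)], [::-247]); ([::(469,4); (484,8); (558,8);
  (476,14)], [::484; 558; 469; 570; 318; 611; 400; 529; 505; 241; 365]);
  ([::(46,10); (39,10); (77,14)], [::46; 39]); ([::(400,4)], [::-248; -244;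
  318; 186; 326; 269; -241; 518; 347; 93; 373; -201; 365; 132; 219; 290; 459;
  466; 541; 441; 285; 469; 484; 558; 476; -249; 339; 555; -135; 258; 72; 257;
  212; 124; 159; 121; 193; 241; 187; 456; 188; 247; 376; 406; 46; 39; 77; -250;
  293; 134; 126; 125; 210; 367; 200; 194; 133; 156; 489; 277; 93; 268; 458;
  217; 208; 340; 493; 267; 88; 53; 155; 354; 301; 292; 38; 256; 315; 235; 207;
  296; 382; 540; 397; 152; 303; 499; 316; 163; 432; 375; 224; 304; 407; 240;
  362; 233; 482; 209; 179; 181; 108; 236; 287; 171; 363; 472; 496; 345]);
  ([::(388,11)], [::400]); ([::(505,10)], [::400]); ([::(231,11)], [::400]);
  ([::(482,11)], [::400]); ([::(109,9)], [::400]); ([::(269,10)], [::400]);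
  ([::(409,11)], [::400]); ([::(594,11)], [::400]); ([::(406,11)], [::400]);
  ([::(318,10)], [::400]); ([::(518,10)], [::400]); ([::(326,10)], [::400]);
  ([::(254,10)], [::400]); ([::(391,11)], [::400]); ([::(471,11)], [::400]);
  ([::(529,11)], [::400]); ([::(155,11)], [::400]); ([::(328,11)], [::400]);
  ([::(365,3); (93,8)], [::505; 241; 254; 124; -221; 132; 518; 373; 93; 326;
  90; 318; 186]); ([::(93,8)], [::-270; -221; 518; 373; -216; 365; 132; 505;
  290; 231; 254; 459; 7; 109; 558; 205; 46; 241; 589; 469; 90; 219; 124; 590;
  570; 318; 186; 484; 422; 615; 326; 541; 168; 476; 339; 523; 466; 572; 419;
  555; 257; 526; 477; 608; 507; 563; 587; 456; 557]); ([::(254,8)], [::505;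
  326; 318; 186; 90; 365; 241; 124]); ([::(241,1)], [::109; 326; 505; 219; 318;
  200; 183; 365; 484; 570; 373; 231; 290; 518; 7; 450; 435; 466; 488; 572; 441;
  558; 547; 298; 501; 526; 607; 609; 590; 469; 352; 591; 589; 477; 266; 555;
  563; 560; 515; 453]); ([::(373,3); (417,9)], [::326; 373; 109; 124; 318; 200;
  183; 219; 7; 247; 29; 484; 572; 35; 86; 333; 501; 570; 114; 459; 352; 357;
  476; 594; 541; 213; 350; 529; 342; 616; 417; 523; 469; 231; 205; 168; 33; 36;
  419; 290; 11; 345; 488; 526; 435; 159; 46; 265; 337; 107; 431; 538; 482; 606;
  425; 257; 22; 471; 178; 422; 217; 193; 268; 80; 25; 496; 207; 301; 76; 134;
  549; 489; 349; 347; 84; 131; 329; 339; 493; 259; 581; 77; 354; 197; 45; 201;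
  72; 540; 135; 499; 40; 270; 502; 125; 266; 586; 436; 188; 274; 184; 341; 316;
  408; 302; 475; 165; 211; 218]); ([::(231,9)], [::326; 109; 124; 505; 318;
  200; 183; 365; 168; 290; 223; 469; 459; 435; 205; 333; 541; 36; 552; 425;
  119; 596; 373; 417; -274; 132; 219; 269; 96; 484; 518; 155; 380; 558; 575;
  466; 305; 297; 450; 335; 533; 159; 149; 441; 547; 512; 530; 266; 285; 406;
  405; 257; 144; 555; 277; 476; 332; 193; 386; 339; 248; 456; 320; 134; 187;
  315; 268; 468; 347; 72; 203; 578; 397; 88; 539; 471; 354; 258; 207; 356; 423;
  259; 52; 388; 337; 267; 251; 282; 217; 278; 482; 125; 173; 289; 396; 577;
  489; 192; 345; 407; 409; 188; 238; 535; 540; 256; 264; 252; 71; 328; 496;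
  316; 418; 399; 548; 422; 447; 451; 154; 430; 503; 283; 291; 148; 415; 209;
  487; 204; 414; 338; 421]); ([::(219,1); (77,12); (191,12); (46,10)], [::219;
  326; 109; 505; 124; 46; 318; 200; 183; 231; 365; 77; 132; 484; 373; 168; 223;
  191; 135; 290; 518; 247; 85; 266; 466; 329; 199; 547; 66; 238; 410; 114; 63;
  181; 166; 175; 173; 185; 25; 159; 476; 239; 82; 49; 257; 226; 138; 339; 193;
  127; 347; 72; 133; 315; 189; 493; 125; 84; 234; 492; 245; 366; 180; 375; 91;
  432; 94; 294; 56; 302; 60]); ([::(339,5); (77,12)], [::326; 109; 505; 124;
  318; 200; 183; 231; 365; 72; 132; 168; 223; 77; 269; 290; 167; 135; 518; 435;
  125; 466; 423; 347; 191; 258; 266; 193; 257; 547; 199; 134; 187; 188; 315;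
  267; 425; 63; 450; 493; 133; 84; 256; 491; 252; 175; 441; 558; 376; 539; 488;
  354; 540; 285; 301; 456; 577; 413; 316; 555; 564; 443; 517; 388; 536; 233;
  447; 387; 560; 543; 580; 396; 416; 366; 471; 320; 546; 479; 492; 375; 337;
  195; 343; 229; 457; 240; 418; 470; 321; 330; 428; 206; 179; 288; 102; 171]);
  ([::(347,11)], [::326; 109; 124; 318; 200; 183; 231; 168; 132; 290; 269; 435;
  135; 219; 77; 191; 46; -276; 484; 333; 459; 541; 339; -277; 258; 423; 422;
  193; 496]); ([::(339,12)], [::326; 109; 422; 124; 505; 318; 200; 183; 231;
  260; 365; 132; 168; 269; 223; 589; 432; 290; 347; 103; 488; 352; 435; 258;
  212; 391; 570; 538; 186; 493; 501; 219; 511; 476; 469; 250; 547; 434; 484;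
  459; 529; 350; 558; 415; 546; 496; 424; 606; 541; 616; 357; 555; 540; 193;
  491; 581; 489; 602; 349; 188; 579; 341; 316; 601; 475]); ([::(339,8)],
  [::326; 109; 422; 124; 505; 186; 318; 200; 183; 231; 365; 90; 168; 132; 589;
  488; 34; 290; 269; 432; 570; 35; 435; 558; 53; 518; 476; 17; 135; 450; 466;
  484; 212; 555; 66; 547; 333; 606; 219; 511; 350; 285; 266; 63; 493; 459; 391;
  448; 191; 159; 500; 552; 377; 578; 189; 347; 257; 293; 581; 492; 127; 425;
  268; 304; 497; 259; 433; 378; 427; 348; 295; 78]); ([::(188,8)], [::326; 109;
  124; 318; 200; 183; 231; 72; 168; 132; 290; 269; 435; 347; 135; 258; 423;
  188; 125]); ([::(193,7)], [::188]); ([::], [::326; 109; 124; 200; 183; 318;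
  231; 365; 72; 193; 168; 132; 223; 257; 290; 269; 315; 541; 187; 63; 419; 435;
  347; 258; 459; 103; 121; 7; 135; 423; 267; 333; 391; 38; 186; 127; 266; 173;
  496; 354; 191; 352; 429; 322; 197; 123; 498; 474; 131; 349; 372; 237; 340;
  218; 370; 209])].


(** The centre has colour 1, the triple 2, 4, 6 colour 0, and vertices 3 and 5 colour 2. Vertex 7
    stays open: properness leaves it colours 2 and 3. *)
Definition M_facts : clause :=
  [:: (1, 2); (2, 1); (3, 4); (4, 1); (5, 4); (6, 1)].

Lemma M_unit_distance : unit_distance M_graph.
Proof. by vm_compute. Qed.

Lemma M_refuted : refutes M_graph M_facts [::] M_proof.
Proof. by vm_compute. Qed.

Lemma M_uncolourable (f : positive -> 'I_4) :
  (forall v u, u \in neighbours (table 1 M_graph) v ->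
    colour f v <> colour f u) ->
  colour f 1 = inord 1 -> colour f 2 = inord 0 -> colour f 3 = inord 2 ->
  colour f 4 = inord 0 -> colour f 5 = inord 2 -> colour f 6 = inord 0 -> False.
Proof.
move=> fg f1 f2 f3 f4 f5 f6.
apply: (@refutes_sound f _ M_facts [::] M_proof fg _ isT M_refuted).
apply/allP => -[v m]; rewrite !inE.
by do ![case/orP]; move=> /eqP[-> ->];
  rewrite ?(f1, f2, f3, f4, f5, f6) /allowed inordK.
Qed.

Local Close Scope Z_scope.
Local Open Scope complex_scope.
Local Open Scope ring_scope.

(** * From integer coordinates to complex numbers *)

Section Embedding.
Variable R : rcfType.

(** Passing through [int] makes this a composite of ring morphisms, so the generic morphism lemmas
    apply to it. *)
Definition real_of_Z (n : Z) : R := (int_of_Z n)%:~R.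

HB.instance Definition _ := GRing.RMorphism.copy real_of_Z (intr \o int_of_Z).

(** sqrt 33 is written as the product of the two other roots, so that only their squares have to be
    known. *)
Definition emb (p : point) : R[i] :=
  let: (a, b, c, d) := p in
  let x := Num.sqrt 3%:R : R in let y := Num.sqrt 11%:R : R in
  ((real_of_Z a + real_of_Z b * (x * y)) / 12%:R) +i*
  ((real_of_Z c * x + real_of_Z d * y) / 12%:R).

Lemma embB p q : emb (subp p q) = emb p - emb q.
Proof.
case: p => [[[a b] c] d]; case: q => [[[a' b'] c'] d'].
have B m n : real_of_Z (Z.sub m n) = real_of_Z m - real_of_Z n.
  exact: (rmorphB real_of_Z m n).
by rewrite /= !B; apply/eqP; rewrite eq_complex /=; apply/andP; split;
  apply/eqP; ring.
Qed.

Lemma sqr_sqrt_nat n : Num.sqrt n%:R ^+ 2 = n%:R :> R.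
Proof. by rewrite sqr_sqrtr ?ler0n. Qed.

Lemma norm_emb p : unit_vector p -> `|emb p| = 1.
Proof.
case: p => [[[a b] c] d]; rewrite /unit_vector.
move=> /andP[/Z.eqb_eq /(congr1 real_of_Z) E1] /Z.eqb_eq /(congr1 real_of_Z) E2.
have D m n : real_of_Z (Z.add m n) = real_of_Z m + real_of_Z n.
  exact: (rmorphD real_of_Z m n).
have M m n : real_of_Z (Z.mul m n) = real_of_Z m * real_of_Z n.
  exact: (rmorphM real_of_Z m n).
rewrite normc_def /=; set s := _ + _; suff ->: s = 1 by rewrite sqrtr1.
move: E1 E2; rewrite !(D, M) {D M}.
have -> : real_of_Z (Zpos 33) = 33%:R by [].
have -> : real_of_Z (Zpos 3) = 3%:R by [].
have -> : real_of_Z (Zpos 11) = 11%:R by [].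
have -> : real_of_Z (Zpos 144) = 144%:R by [].
have -> : real_of_Z Z0 = 0 by [].
rewrite /s {s}; have := sqr_sqrt_nat 3; have := sqr_sqrt_nat 11.
set x := Num.sqrt 3%:R; set y := Num.sqrt 11%:R => y2 x2.
move: (real_of_Z a) (real_of_Z b) (real_of_Z c) (real_of_Z d) => A B C D E1 E2.
(* Collects the part with even powers of both roots and the multiple of [x * y]; [E2] kills the
   latter and [E1] evaluates the former. *)
have -> : ((A + B * (x * y)) / 12%:R) ^+ 2 + ((C * x + D * y) / 12%:R) ^+ 2 =
  (A * A + B * B * (x ^+ 2 * y ^+ 2) + C * C * x ^+ 2 + D * D * y ^+ 2
   + (A * B + C * D) * (x * y) *+ 2) / 144%:R by field.
rewrite x2 y2 E2 mul0r mul0rn addr0 (_ : _ + _ + _ + _ = 144%:R).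
  by rewrite divff ?pnatr_eq0.
by rewrite -E1; ring.
Qed.

Definition omega : R[i] := emb (hex 1).

Lemma emb0 : emb origin = 0.
Proof.
by apply/eqP; rewrite eq_complex /= rmorph0 !mul0r addr0 mul0r eqxx.
Qed.

Lemma emb_hex0 : emb (hex 0) = 1.
Proof.
apply/eqP; rewrite eq_complex /=.
have -> : real_of_Z (Zpos 12) = 12%:R by [].
by rewrite rmorph0 !mul0r !addr0 mul0r divff ?pnatr_eq0 // !eqxx.
Qed.

(** The minimal polynomial of a primitive sixth root of unity; the other relations between powers of
    [omega] follow from it. *)
Lemma omega_sqr : omega ^+ 2 = omega - 1.
Proof.
apply/eqP; rewrite expr2 eq_complex /=.
have -> : real_of_Z (Zpos 6) = 6%:R by [].
rewrite rmorph0; have := sqr_sqrt_nat 3; set x := Num.sqrt 3%:R => x2.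
apply/andP; split; apply/eqP.
  rewrite !mul0r !addr0 -[X in X - _]expr2 -[X in _ - X]expr2 !expr_div_n.
  by rewrite exprMn x2; field.
by rewrite oppr0; field.
Qed.

Lemma omega_cube : omega ^+ 3 = -1.
Proof.
by rewrite exprS omega_sqr mulrBr mulr1 -expr2 omega_sqr addrAC subrr sub0r.
Qed.

Lemma emb_hex k : (k < 6)%N -> emb (hex k) = omega ^+ k.
Proof.
(* By computation [hex 2] is [hex 1] minus [hex 0], and each of the last three vertices is [origin]
   minus one of the first three, so [embB] reduces all to known cases. *)
have h2 : emb (hex 2) = omega ^+ 2 by rewrite omega_sqr -emb_hex0 -embB.
case: k => [|[|[|[|[|[|//]]]]]] _ //; first exact: emb_hex0.
- by rewrite omega_cube -emb_hex0 -[RHS]sub0r -emb0 -embB.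
- by rewrite exprSr omega_cube mulN1r -[RHS]sub0r -emb0 -embB.
- by rewrite (exprD _ 3 2) omega_cube mulN1r -h2 -[RHS]sub0r -emb0 -embB.
Qed.

End Embedding.

(** * Chords of the unit circle and permutations of the colours *)

Lemma real_complexVnK (R : rcfType) n :
  (n.+1%:R^-1)%:C * n.+1%:R = 1 :> R[i].
Proof.
have -> : n.+1%:R = (n.+1%:R)%:C :> R[i] by rewrite rmorph_nat.
by rewrite -rmorphM /= mulVf // pnatr_eq0.
Qed.

(** If x is the real part of a unit t, then |t - 1|^2 = 2 - 2 x, which dictates [x]; the bounds on
    [d] keep it between -1 and 1. Multiplication by t is the rotation needed: chord 1/2 moves points
    at distance 2 by 1, and chord 1/4 does so at distance 4. *)
Lemma exists_chord (R : rcfType) (d : R) : 0 <= d <= 2%:R ->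
  exists2 t : R[i], `|t| = 1 & `|t - 1| = d%:C.
Proof.
move=> /andP[d0 d2]; pose x := 1 - d ^+ 2 / 2%:R.
have d4 : d ^+ 2 <= 4%:R.
  by rewrite (_ : 4%:R = 2%:R ^+ 2) ?lerXn2r // ?nnegrE ?ler0n // -natrX.
have x1 : 0 <= 1 - x ^+ 2.
  have dd := sqr_ge0 d; rewrite subr_ge0 -[leRHS](expr1n _ 2).
  rewrite -[leLHS]real_normK ?num_real //.
  by rewrite lerXn2r ?nnegrE // ler_norml /x; apply/andP; split; lra.
exists (x +i* Num.sqrt (1 - x ^+ 2)); rewrite normc_def /= ?subr0 sqr_sqrtr //.
  by rewrite addrC subrK sqrtr1.
rewrite (_ : _ + _ = d ^+ 2) ?sqrtr_sqr ?ger0_norm //.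
by rewrite /x; field.
Qed.

Lemma exists_perm3 (a b q : 'I_4) : a != b -> a != q -> b != q ->
  exists s : 'S_4, [/\ s a = inord 0, s b = inord 1 & s q = inord 2].
Proof.
move=> ab aq bq.
(* Each transposition puts the next colour in its place and fixes those already placed. *)
pose s1 := tperm a (inord 0); pose s2 := tperm (s1 b) (inord 1).
pose s3 := tperm (s2 (s1 q)) (inord 2).
have n01 : inord 0 != inord 1 :> 'I_4 by rewrite -val_eqE /= !inordK.
have n02 : inord 0 != inord 2 :> 'I_4 by rewrite -val_eqE /= !inordK.
have n12 : inord 1 != inord 2 :> 'I_4 by rewrite -val_eqE /= !inordK.
have e1 : s1 a = inord 0 by rewrite tpermL.
have e2 : s2 (s1 a) = inord 0.
  by rewrite tpermD // ?e1 1?eq_sym // -e1 (inj_eq perm_inj).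
have e3 : s2 (s1 b) = inord 1 by rewrite tpermL.
exists (s1 * s2 * s3)%g; rewrite !permM e2 e3; split; last exact: tpermL.
- by rewrite tpermD // 1?eq_sym // -e2 !(inj_eq perm_inj).
- by rewrite tpermD // 1?eq_sym // -e3 !(inj_eq perm_inj).
Qed.

(** * A proper colouring of the plane has no monochromatic triple *)

Section Plane.
Variables (R : realType) (c : R[i] -> 'I_4).
Hypothesis proper_c : proper_colouring c.
Local Notation w := (omega R).

Lemma norm_omega : `|w| = 1.
Proof. exact: norm_emb. Qed.

Lemma mul_omegaD u i j : u * w ^+ i * w ^+ j = u * w ^+ (i + j).
Proof. by rewrite -mulrA -exprD. Qed.

Lemma omega_add6 k : w ^+ (6 + k) = w ^+ k.
Proof. by rewrite exprD (exprD _ 3 3) omega_cube mulrNN !mul1r. Qed.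

Lemma norm_mul_omega u k : `|u| = 1 -> `|u * w ^+ k| = 1.
Proof. by move=> u1; rewrite normrM normrX norm_omega expr1n u1 mulr1. Qed.

(** The colouring of [g] seen through the isometry that puts its origin at [z] and turns it by [u],
    with colours renamed by [s]. Moving the graph this way transfers one computation to all
    positions. *)
Definition view (g : graph) (s : 'S_4) (z u : R[i]) (v : positive) : 'I_4 :=
  s (c (z + u * emb R (coord g (Zpos v)))).

Lemma colour_view g s z u v :
  colour (view g s z u) v = s (c (z + u * emb R (coord g v))).
Proof. by rewrite /colour /view /coord; case: v. Qed.

Lemma view_proper g s z u : `|u| = 1 -> unit_distance g ->
  forall v v', v' \in neighbours (table 1 g) v ->
  colour (view g s z u) v <> colour (view g s z u) v'.
Proof.
move=> u1 /allP gP v v'; rewrite !colour_view /neighbours [coord g v]/coord.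
case E: (PM.find _ _) => [x|//] v'x.
have /norm_emb := allP (gP _ (find_table E)) _ v'x.
move=> /(_ R); rewrite embB => d1 /perm_inj; apply: proper_c.
by rewrite opprD addrACA subrr add0r -mulrBr normrM u1 d1 mulr1.
Qed.

Definition mono_triple (z u : R[i]) : Prop :=
  c (z + u) = c (z + u * w ^+ 2) /\ c (z + u) = c (z + u * w ^+ 4).


Lemma proper_step z v : `|v| = 1 -> c (z + v) != c z.
Proof. by move=> v1; apply/eqP/proper_c; rewrite addrAC subrr add0r. Qed.

Lemma triangle_colours z u : `|u| = 1 ->
  [/\ c z != c (z + u), c z != c (z + u * w ^+ 1) &
      c (z + u) != c (z + u * w ^+ 1)].
Proof.
move=> u1; split.
- by rewrite eq_sym proper_step.
- by rewrite eq_sym proper_step // norm_mul_omega.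
(* The two points differ by u w - u = u w^2, a unit vector. *)
- have -> : z + u * w ^+ 1 = z + u + u * w ^+ 2.
    by rewrite omega_sqr mulrBr mulr1 addrA addrAC addrK.
  by rewrite eq_sym proper_step // norm_mul_omega.
Qed.

(** Renaming the colours of the triple, of the centre and of the points 1 and 3 to 0, 1 and 2
    produces exactly [M_facts]. *)
Lemma coloured_wheel_absurd z u : `|u| = 1 -> mono_triple z u ->
  c (z + u * w ^+ 1) = c (z + u * w ^+ 3) -> False.
Proof.
move=> u1 [ac ae] bd; have [ab aq bq] := triangle_colours z u1.
rewrite eq_sym in ab; have [s [s0 s1 s2]] := exists_perm3 ab bq aq.
pose f := view M_graph s z u.
have fE v p : coord M_graph v = p -> colour f v = s (c (z + u * emb R p)).
  by move=> <-; apply: colour_view.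
apply: (@M_uncolourable f).
- exact: view_proper M_unit_distance.
- by rewrite (fE _ origin) // emb0 mulr0 addr0.
- by rewrite (fE _ (hex 0)) // emb_hex // mulr1.
- by rewrite (fE _ (hex 1)) // emb_hex.
- by rewrite (fE _ (hex 2)) // emb_hex // -ac.
- by rewrite (fE _ (hex 3)) // emb_hex // -bd.
- by rewrite (fE _ (hex 4)) // emb_hex // -ae.
Qed.

(** Turning by w^2 preserves the triple and permutes the other three points cyclically, so whichever
    two of them agree can be brought to positions 1 and 3. *)
Lemma mono_triple_rotate z u : mono_triple z u -> mono_triple z (u * w ^+ 2).
Proof.
move=> [e1 e2]; split; rewrite mul_omegaD -e1 ?e2 //.
by rewrite (omega_add6 0) mulr1.
Qed.

Lemma no_mono_triple z u : `|u| = 1 -> ~ mono_triple z u.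
Proof.
move=> u1 m0; have m2 := mono_triple_rotate m0.
have m4 := mono_triple_rotate m2.
have u2 := norm_mul_omega 2 u1; have u4 := norm_mul_omega 2 u2.
(* The three remaining points of the wheel avoid the colours of the centre
   and of the triple, so two of them agree. *)
have [e|n13] := eqVneq (c (z + u * w ^+ 1)) (c (z + u * w ^+ 3)).
  exact: coloured_wheel_absurd u1 m0 e.
have [e|n35] := eqVneq (c (z + u * w ^+ 3)) (c (z + u * w ^+ 5)).
  by apply: coloured_wheel_absurd u2 m2 _; rewrite !mul_omegaD.
have [e|n51] := eqVneq (c (z + u * w ^+ 5)) (c (z + u * w ^+ 1)).
  apply: coloured_wheel_absurd u4 m4 _.
  by rewrite !mul_omegaD (omega_add6 1).
have [ab aq bq] := triangle_colours z u1.
have [_ aq3 bq3] := triangle_colours z u2.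
have [_ aq5 bq5] := triangle_colours z u4.
move: m0 aq3 bq3 aq5 bq5 {m2 m4} => [e2 e4].
rewrite !mul_omegaD -e2 -e4 => aq3 bq3 aq5 bq5.
move: ab aq bq n13 n35 n51 aq3 bq3 aq5 bq5.
move: (c z) (c (z + u)) (c (z + u * w ^+ 1)) (c (z + u * w ^+ 3)).
move: (c (z + u * w ^+ 5)).
by do 5!case=> [[|[|[|[|//]]]] ?].
Qed.

(** The difference of opposite hexagon vertices computes to the coordinates of vertex 8 + [k] of
    [J_graph], which lets [colour_link] conclude by conversion. *)
Lemma emb_link k : (k < 3)%N ->
  emb R (subp (hex k) (hex k.+3)) = 2%:R * w ^+ k.
Proof.
move=> k3; rewrite embB !emb_hex // ?(leq_trans k3) //.
by rewrite -addn3 exprD omega_cube mulrN1 opprK -mulr2n mulr_natl.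
Qed.

Lemma emb_link_opp k : (k < 3)%N ->
  emb R (subp (hex k.+3) (hex k)) = - (2%:R * w ^+ k).
Proof. by move=> k3; rewrite -emb_link // !embB opprB. Qed.

(** Each listed triple is a triple of the unit hexagon around the image [z'] of its centre [h], so
    [no_mono_triple] at [z'] makes two of its colours differ. *)
Lemma view_wheels s z u : `|u| = 1 ->
  all (holds (view J_graph s z u)) wheel_clauses.
Proof.
move=> u1; apply/allP => cl /flattenP[cls /mapP[[[[h p] q] r] tJ ->]].
have /hasP[k k2 /and3P[/eqP xp /eqP xq /eqP xr]] := allP J_triples_wheel _ tJ.
have {}k2 : (k < 2)%N by rewrite mem_iota in k2.
move: cl; apply/allP; set f := view _ _ _ _.
pose z' := z + u * emb R (coord J_graph h).
have cE v j : (j < 6)%N -> subp (coord J_graph v) (coord J_graph h) = hex j ->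
    colour f v = s (c (z' + u * w ^+ j)).
  move=> j6 E; rewrite colour_view -emb_hex // -E embB /z' -addrA -mulrDr.
  by rewrite [emb _ _ + (_ - _)]addrC subrK.
have k6 j : (j <= 4)%N -> (k + j < 6)%N by apply: leq_add k2.
have Ep := cE _ _ (leq_trans k2 (isT : 2 <= 6)%N) xp.
have Eq := cE _ _ (k6 2 isT) xq; have Er := cE _ _ (k6 4 isT) xr.
have [e|ne] := eqVneq (colour f p) (colour f q); last first.
  by apply: holds_not_all_equal ne; rewrite !inE eqxx ?orbT.
have [e'|ne] := eqVneq (colour f p) (colour f r); last first.
  by apply: holds_not_all_equal ne; rewrite !inE eqxx ?orbT.
case: (@no_mono_triple z' (u * w ^+ k)); first exact: norm_mul_omega.
split; rewrite mul_omegaD; apply: (@perm_inj _ s).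
  by rewrite -Ep -Eq.
by rewrite -Ep -Er.
Qed.

(** The renaming [s] is chosen inside the proof from the triangle of [J_facts]. The additional
    assumptions must therefore hold for every [s] sending the colour of [z] to 0; this suits
    conditions that mention only that colour or equality of colours. *)
Lemma J_absurd z u facts init r : `|u| = 1 ->
  refutes J_graph (facts ++ J_facts) (init ++ wheel_clauses) r ->
  (forall s : 'S_4, s (c z) = inord 0 ->
    all (fun e => allowed e.2 (colour (view J_graph s z u) e.1)) facts &&
    all (holds (view J_graph s z u)) init) ->
  False.
Proof.
move=> u1 refuted extra; have [ab aq bq] := triangle_colours z u1.
have [s [s0 s1 s2]] := exists_perm3 ab aq bq.
have /andP[factsP initP] := extra s s0.
apply: (refutes_sound (f := view J_graph s z u)) refuted.
- exact: view_proper J_unit_distance.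
- rewrite all_cat factsP; apply/allP => -[v m]; rewrite !inE.
  do ![case/orP]; move=> /eqP[-> ->]; rewrite colour_view.
  + rewrite [coord _ _](_ : _ = origin) // emb0 mulr0 addr0 s0.
    by rewrite /allowed inordK.
  + rewrite [coord _ _](_ : _ = hex 0) // emb_hex // mulr1 s1.
    by rewrite /allowed inordK.
  + rewrite [coord _ _](_ : _ = hex 1) // emb_hex // s2.
    by rewrite /allowed inordK.
- by rewrite all_cat initP view_wheels.
Qed.

(** * Antipodal pairs at distance 2 from the centre, and the final rotations *)

Lemma colour_link s z u k : (k < 3)%N ->
  colour (view J_graph s z u) (Z.of_nat (8 + k)) =
    s (c (z + u * (2%:R * w ^+ k))) /\
  colour (view J_graph s z u) (Z.of_nat (11 + k)) =
    s (c (z - u * (2%:R * w ^+ k))).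
Proof.
move=> k3; rewrite !colour_view -mulrN -emb_link_opp // -emb_link //.
by case: k k3 => [|[|[|//]]].
Qed.

Lemma link_centre z u : `|u| = 1 -> exists2 k, (k < 3)%N &
  c (z + u * (2%:R * w ^+ k)) = c z /\ c (z - u * (2%:R * w ^+ k)) = c z.
Proof.
move=> u1; pose P k := (c (z + u * (2%:R * w ^+ k)) == c z) &&
  (c (z - u * (2%:R * w ^+ k)) == c z).
have [/hasP[k k3 /andP[/eqP e /eqP e']]|/hasPn noP] := boolP (has P (iota 0 3)).
  by exists k => //; rewrite mem_iota in k3.
exfalso.
apply: (J_absurd (z := z) (facts := [::]) u1 link_clauses_refuted) => s s0.
(* Since [s] sends the colour of [z] to 0, the failure of [P] at each [k] is one of
   [link_clauses]. *)
have {}noP k : (k < 3)%N ->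
    (colour (view J_graph s z u) (Z.of_nat (8 + k)) != inord 0) ||
    (colour (view J_graph s z u) (Z.of_nat (11 + k)) != inord 0).
  move=> k3; have [-> ->] := colour_link s z u k3.
  rewrite -s0 !(inj_eq perm_inj) -negb_and.
  by apply: noP; rewrite mem_iota.
rewrite /link_clauses /all !holds_pair14.
by rewrite (noP 0%N) // (noP 1%N) // (noP 2%N).
Qed.

Lemma link_antipodal z u : `|u| = 1 ->
  c (z + u * 2%:R) <> c z -> c (z - u * 2%:R) <> c z ->
  forall k, (k < 3)%N ->
  c (z + u * (2%:R * w ^+ k)) = c (z - u * (2%:R * w ^+ k)).
Proof.
move=> u1 n0 n3 k k3; apply/eqP; apply/negPn/negP => ne.
apply: (J_absurd (z := z) u1 (link_facts_refuted k3)) => s s0.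
apply/andP; split.
  (* Index 0 gives the vertices 8 and 11 of [link_facts]. *)
  have [] := @colour_link s z u 0 isT; rewrite expr0 mulr1.
  have m0 : s (c (z + u * 2%:R)) != inord 0.
    by apply/eqP; rewrite -s0 => /perm_inj.
  have m3 : s (c (z - u * 2%:R)) != inord 0.
    by apply/eqP; rewrite -s0 => /perm_inj.
  move=> E E'; apply/and3P; split=> //.
    by rewrite [allowed _ _]allowed14 [colour _ _]E.
  by rewrite [allowed _ _]allowed14 [colour _ _]E'.
have [E E'] := colour_link s z u k3.
apply: (@holds_not_all_equal _ _ (Z.of_nat (8 + k)) (Z.of_nat (11 + k))).
- by rewrite inE eqxx.
- by rewrite !inE eqxx orbT.
- by rewrite E E' (inj_eq perm_inj).
Qed.

Lemma antipodal z u : `|u| = 1 -> c (z + u * 2%:R) = c (z - u * 2%:R).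
Proof.
move=> u1.
have [t t1 tw] : exists2 t : R[i], `|t| = 1 & `|t - 1| = (2%:R^-1)%:C.
  by apply: exists_chord; lra.
(* Which pair of the turned copy has the colour of [z] is unknown, so the unturned copy is used in
   direction [u * w ^+ k], aligned with that pair. *)
have [k k3 [e e']] : exists2 k, (k < 3)%N &
    c (z + u * t * (2%:R * w ^+ k)) = c z /\
    c (z - u * t * (2%:R * w ^+ k)) = c z.
  by apply: link_centre; rewrite normrM u1 t1 mulr1.
have d1 : `|u * t * (2%:R * w ^+ k) - u * w ^+ k * 2%:R| = 1.
  rewrite (_ : _ - _ = (u * w ^+ k) * (t - 1) * 2%:R); last by ring.
  rewrite normrM [`|_ * (t - 1)|]normrM tw norm_mul_omega // normr_nat.
  by rewrite mul1r real_complexVnK.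
have uk1 := norm_mul_omega k u1.
have n : c (z + u * w ^+ k * 2%:R) <> c z.
  by rewrite -e => /esym; apply: proper_c; rewrite opprD addrACA subrr add0r.
have n' : c (z - u * w ^+ k * 2%:R) <> c z.
  rewrite -e' => /esym; apply: proper_c.
  by rewrite opprD addrACA subrr add0r -opprD normrN.
have E := link_antipodal uk1 n n'.
(* All three pairs in the directions u w^(k + j) are monochromatic. The pair in direction u has k +
   j divisible by 3; for k + j = 3 its ends are merely swapped, as w^3 = -1. *)
case: k k3 {e e' d1 uk1 n n'} E => [|[|[|//]]] _ E.
- by have := E 0%N isT; rewrite !expr0 !mulr1.
- have := E 2%N isT.
  rewrite (_ : u * w ^+ 1 * (2%:R * w ^+ 2) = - (u * 2%:R)) ?opprK //.
  by rewrite mulrCA -mulrA -exprD omega_cube mulrN1 mulrN mulrC.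
- have := E 1%N isT.
  rewrite (_ : u * w ^+ 2 * (2%:R * w ^+ 1) = - (u * 2%:R)) ?opprK //.
  by rewrite mulrCA -mulrA -exprD omega_cube mulrN1 mulrN mulrC.
Qed.

Lemma no_proper_colouring : False.
Proof.
have [t t1 tw] : exists2 t : R[i], `|t| = 1 & `|t - 1| = (4%:R^-1)%:C.
  by apply: exists_chord; lra.
have c4 u : `|u| = 1 -> c (u * 4%:R) = c 0.
  (* Around the centre 2 u, the antipodal points in direction u are 4 u and 0. *)
  move=> u1; have := antipodal (u * 2%:R) u1.
  by rewrite subrr -mulrDr -natrD.
apply: (@proper_c (t * 4%:R) (1 * 4%:R)); last by rewrite !c4 ?normr1.
by rewrite -mulrBl normrM tw normr_nat real_complexVnK.
Qed.

End Plane.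

Theorem mainTheorem9 (R : realType) (c0 : R[i] -> 'I_4)
    (mu : set (symE R) -> R) (d : R) (A B : R[i]) :
  proper_colouring c0 ->
  fin_additive_probability mu ->
  left_invariant mu ->
  0 <= d <= (Num.sqrt 5 - 1) / Num.sqrt 3 ->
  `|A - B| = d%:C ->
  1 / 325 <= mono_prob c0 mu A B.
Proof. by move=> /no_proper_colouring. Qed.
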